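(* Assume $1<q<\infty$. Then the equation $$\nabla\times\nabla\times E+E=|E|^{2q-2}E\qquad\text{in }\mathbb{R}^3$$ does not have a ground state solution in $H^1(\mathrm{curl};\mathbb{R}^3)\cap L^{2q}(\mathbb{R}^3;\mathbb{R}^3)$.
   Context: $H^1(\mathrm{curl};\mathbb{R}^3)=\{E\in L^2(\mathbb{R}^3;\mathbb{R}^3):\nabla\times E\in L^2(\mathbb{R}^3;\mathbb{R}^3)\}$, where $\nabla\times E$ is the distributional curl. The energy functional associated with the equation is $$\mathcal I(E)=\frac12\int_{\mathbb{R}^3}|\nabla\times E|^2+|E|^2\,dx-\frac1{2q}\int_{\mathbb{R}^3}|E|^{2q}\,dx ,\qquad E\in H^1(\mathrm{curl};\mathbb{R}^3)\cap L^{2q}(\mathbb{R}^3;\mathbb{R}^3).$$ Solutions are critical points of $\mathcal I$ (weak solutions), i.e. $\mathcal I'(E)=0$. A ground state solution is a nontrivial ($E\neq0$) solution of $\mathcal I'(E)=0$ such that $\mathcal I(E)$ is smallest possible among all nontrivial solutions. *)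

(* Defs.v *)
From HB Require Import structures.
From mathcomp Require Import all_boot all_order all_algebra.
From mathcomp Require Import all_classical all_reals all_analysis.

Set Implicit Arguments.
Unset Strict Implicit.
Unset Printing Implicit Defensive.

Import Order.TTheory GRing.Theory Num.Theory.
Import numFieldNormedType.Exports.

Local Open Scope classical_set_scope.
Local Open Scope ring_scope.

Section Curl.
Variable R : realType.

(* Points are triples, so that Fubini applies to the iterated product measure;
   values of vector fields are row vectors. *)
Definition R3 := (R * R * R)%type.

Definition vfield := R3 -> 'rV[R]_3.

(* lebesgue_measure lives on the alias measurableTypeR R of R, which carries
   the Borel sigma-algebra but not the topology. *)
Local Notation mR := (measurableTypeR R).

Definition leb2 : {measure set (mR * mR)%type -> \bar R} :=
  (@lebesgue_measure R \x @lebesgue_measure R)%E.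

Definition leb3 : {measure set (mR * mR * mR)%type -> \bar R} :=
  (leb2 \x @lebesgue_measure R)%E.

(* The library norm on 'rV[R]_3 is the sup norm; |.| here is Euclidean. *)
Definition dot (u v : 'rV[R]_3) : R := \sum_(i < 3) u 0 i * v 0 i.

Definition enorm (u : 'rV[R]_3) : R := Num.sqrt (dot u u).

Definition coord3 (E : vfield) (i : 'I_3) : R3 -> R := fun x => E x 0 i.

Definition basis3 (i : 'I_3) : R3 :=
  ((i == 0)%:R, (i == 1)%:R, (i == 2)%:R).

Definition partial (i : 'I_3) (f : R3 -> R) : R3 -> R := 'D_(basis3 i) f.

Fixpoint Ck (k : nat) (f : R3 -> R) : Prop :=
  match k with
  | 0 => continuous f
  | k'.+1 => forall i, (forall x, derivable f x (basis3 i)) /\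
                       Ck k' (partial i f)
  end.

Definition smooth (f : R3 -> R) : Prop := forall k, Ck k f.

Definition test_field (phi : vfield) : Prop :=
  (forall i, smooth (coord3 phi i)) /\
  compact (closure [set x | phi x != 0]).

(* Indices i + 1 and i + 2 are taken modulo 3 in 'I_3. *)
Definition curl (phi : vfield) : vfield := fun x =>
  \row_(i < 3) (partial (i + 1) (coord3 phi (i + 2)) x -
                partial (i + 2) (coord3 phi (i + 1)) x).

(* Almost everywhere equal fields are not identified. Measurability is with
   respect to the Borel sigma-algebra; this loses no L^p class, since every
   Lebesgue measurable field has a Borel representative. *)
Definition Lp3 (p : R) (E : vfield) : Prop :=
  (forall i, measurable_fun (setT : set (mR * mR * mR)%type) (coord3 E i)) /\
  finite_norm leb3 p%:E (enorm \o E).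

Definition is_weak_curl (E F : vfield) : Prop :=
  forall phi, test_field phi ->
    \int[leb3]_x dot (F x) (phi x) = \int[leb3]_x dot (E x) (curl phi x).

Definition Hcurl (E : vfield) : Prop :=
  Lp3 2 E /\ exists F, Lp3 2 F /\ is_weak_curl E F.

(* For E in Hcurl, the square integrable distributional curl, which is unique
   up to a null set; 0 for any other E. *)
Definition wcurl (E : vfield) : vfield :=
  xget (0 : vfield) [set F | Lp3 2 F /\ is_weak_curl E F].

Section Energy.
Variable q : R.

Definition Xspace (E : vfield) : Prop := Hcurl E /\ Lp3 (2 * q) E.

Definition normX (E : vfield) : R :=
  Num.sqrt (\int[leb3]_x (enorm (wcurl E x) ^+ 2 + enorm (E x) ^+ 2)) +
  (\int[leb3]_x (enorm (E x) `^ (2 * q))) `^ ((2 * q)^-1).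

Definition energy (E : vfield) : R :=
  2^-1 * \int[leb3]_x (enorm (wcurl E x) ^+ 2 + enorm (E x) ^+ 2) -
  (2 * q)^-1 * \int[leb3]_x (enorm (E x) `^ (2 * q)).

(* The Frechet derivative of energy at E, on Xspace normed by normX, is
   the zero functional. *)
Definition critical_point (E : vfield) : Prop :=
  forall eps : R, 0 < eps -> exists2 delta : R, 0 < delta &
    forall H, Xspace H -> normX H < delta ->
      `|energy (E + H) - energy E| <= eps * normX H.

Definition solution (E : vfield) : Prop := Xspace E /\ critical_point E.

Definition nontrivial (E : vfield) : Prop :=
  ~ {ae leb3, forall x, E x = 0}.

Definition ground_state (E : vfield) : Prop :=
  [/\ solution E, nontrivial E &
      forall G, solution G -> nontrivial G -> energy E <= energy G].

End Energy.
End Curl.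

(* Main.v *)
From HB Require Import structures.
Require Import Defs.
From mathcomp Require Import all_boot all_order all_algebra.
From mathcomp Require Import all_classical all_reals all_analysis.
From mathcomp Require Import measurable_realfun.
From mathcomp Require Import ring lra.

(** Nontrivial solutions have positive energy, and there are nontrivial
    solutions of arbitrarily small energy; so the energy has no minimum among
    them.

    Positivity. If E is a solution, differentiating the energy in the direction
    E gives (critical_point_nehari)
      int (|curl E|^2 + |E|^2) = int |E|^(2q),
    hence the energy of E is (1/2 - 1/(2q)) int (|curl E|^2 + |E|^2), which is
    positive when q > 1 and E is not zero almost everywhere.

    Small energy. A curl-free field E with |E| equal to 0 or 1 everywhere
    satisfies |E|^(2q-2) E = E and curl curl E = 0, so it solves the equation;
    its energy is (1/2 - 1/(2q)) times the volume of its support. Such fields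
    are gradients of Lipschitz functions whose slope is 0 or 1. The choice made
    here is the gradient, up to sign, of
      u(x) = max (0, r - |x_1| - |x_2| - |x_3|) / sqrt 3,
    which is supported in an octahedron of volume at most (2r)^3. On lines
    parallel to the axes u is a tent, so that integration by parts against a
    test field reduces to the fundamental theorem of calculus (octa_by_parts),
    and u pairs with the divergence of a curl, which vanishes because mixed
    derivatives commute (octa_curl_free).

    Two points need more than algebra. First, the functional is evaluated on
    wcurl E, which is some weak curl of E: to compute with it, the weak curl has
    to be unique almost everywhere. This is the fundamental lemma of the
    calculus of variations (test_functions_separate), proved with products of
    functions exp (-1/t) that converge to indicators of boxes and with a Dynkin
    system argument that passes from boxes to measurable sets. Second, being a
    critical point is a statement on Frechet derivatives: the expansion of
    |E + H|^(2q) around a field of norm 0 or 1 must have a remainder of order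
    |H|^2 + |H|^(2q), uniformly (power_remainder), although t^q need not be
    twice differentiable at 0. *)

Set Implicit Arguments.
Unset Strict Implicit.
Unset Printing Implicit Defensive.

Import Order.TTheory GRing.Theory Num.Theory.
Import numFieldNormedType.Exports.

Local Open Scope classical_set_scope.
Local Open Scope ring_scope.

(** * Measurability and Fubini in three dimensions *)

Section floor_approx.
Variable R : realType.

Definition grid (n : nat) (t : R) : R := (Num.floor (t * n.+1%:R))%:~R / n.+1%:R.

Lemma grid_cvg (t : R) : grid n t @[n --> \oo] --> t.
Proof.
apply/cvgrPdist_lt => e e0; near=> n.
have n0 : 0 < n.+1%:R :> R by rewrite ltr0n.
have /andP[h1 h2] := floor_itv (t * n.+1%:R).
have -> : t - grid n t = (t * n.+1%:R - (Num.floor (t * n.+1%:R))%:~R) / n.+1%:R.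
  by rewrite mulrBl mulfK// gt_eqF.
rewrite normrM normfV (gtr0_norm n0) ltr_pdivrMr//.
rewrite ger0_norm ?subr_ge0//.
apply: (@lt_le_trans _ _ 1).
  by rewrite ltrBlDl; move: h2; rewrite intrD1.
rewrite -ler_pdivrMr// div1r.
apply: ltW; near: n; exact: near_infty_natSinv_lt (PosNum e0).
Unshelve. all: by end_near. Qed.

(** Replacing the last variable by grid points makes f a pointwise limit of
    functions that, on each of countably many slabs, do not depend on that
    variable. Only separate regularity is used, which is why the lemma can be
    iterated one coordinate at a time. *)
Lemma caratheodory_measurable d (T : measurableType d) (f : T -> R -> R) :
  (forall y, measurable_fun setT (f ^~ y)) -> (forall x, continuous (f x)) ->
  measurable_fun setT (fun p : T * measurableTypeR R => f p.1 p.2).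
Proof.
move=> mf cf.
apply: (@measurable_fun_cvg _ _ _ _
  (fun n (p : T * measurableTypeR R) => f p.1 (grid n p.2))).
  move=> n _ Y mY; rewrite setTI.
  rewrite [X in measurable X](_ : _ = \bigcup_(k : int)
     ((f ^~ (k%:~R / n.+1%:R) @^-1` Y) `*`
      [set t : measurableTypeR R | (Num.floor (t * n.+1%:R) = k)])); last first.
    apply/seteqP; split => [[x y] /= h|[x y] /= [k _ [/= h hk]]];
      last by rewrite /grid hk.
    by exists (Num.floor (y * n.+1%:R)).
  apply: countable_bigcupT_measurable => // k; apply: measurableX.
    by rewrite -[X in measurable X]setTI; apply: mf.
  rewrite [X in measurable X](_ : _ =
     `[k%:~R / n.+1%:R, (k + 1)%:~R / n.+1%:R[%classic); first exact: measurable_itv.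
  apply/seteqP; split => t /=; rewrite in_itv/=.
    by move=> <-; rewrite ler_pdivrMr// ltr_pdivlMr// floor_itv.
  by rewrite ler_pdivrMr// ltr_pdivlMr// => /floor_def.
move=> [x y] _ /=; exact: (cvg_comp _ _ (@grid_cvg y) (cf x y)).
Qed.
End floor_approx.

Section fubini_zero.
Local Open Scope ereal_scope.
Context d1 d2 (T1 : measurableType d1) (T2 : measurableType d2) (R : realType).
Variables (m1 : {sigma_finite_measure set T1 -> \bar R})
  (m2 : {sigma_finite_measure set T2 -> \bar R}).

Lemma fubini_slice2_eq0 (f : T1 * T2 -> \bar R) :
  (m1 \x m2).-integrable setT f ->
  (forall x, \int[m2]_y f (x, y) = 0) -> \int[m1 \x m2]_z f z = 0.
Proof.
move=> fi f0; rewrite -integral12_prod_meas1//; apply: integral0_eq => x _.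
exact: f0.
Qed.

Lemma fubini_slice1_eq0 (f : T1 * T2 -> \bar R) :
  (m1 \x m2).-integrable setT f ->
  {ae m2, forall y, \int[m1]_x f (x, y) = 0} -> \int[m1 \x m2]_z f z = 0.
Proof.
move=> fi f0; rewrite -integral21_prod_meas1//.
rewrite (@ae_eq_integral _ _ _ m2 setT (cst 0) (fubini_G m1 f))//.
- by rewrite integral0.
- by apply: (measurable_fubini_G fi).
- by apply: filterS f0 => y + _; rewrite /fubini_G.
Qed.

End fubini_zero.

Section leb3_facts.
Variable R : realType.
Local Notation mR := (measurableTypeR R).
Local Notation mu := (@lebesgue_measure R).
Local Notation T3 := (mR * mR * mR)%type.

(** The planar measure under a name of its own, so that a sigma-finite structure
    can be attached to it; Fubini for [leb3] requires one on the first factor. *)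
Definition sfleb2 : set (mR * mR)%type -> \bar R := (mu \x mu)%E.

HB.instance Definition _ := Measure.on sfleb2.

Lemma sfleb2_sigma_finite : sigma_finite setT sfleb2.
Proof.
exists (fun n => `[- n%:R, n%:R] `*` `[- n%:R, n%:R]).
  apply/esym/seteqP; split => // -[x y] _.
  exists (Num.bound (Num.max `|x| `|y|)) => //=.
  have := @archi_boundP _ (Num.max `|x| `|y|).
  rewrite le_max normr_ge0 => /(_ isT); rewrite gt_max => /andP[hx hy].
  by rewrite !in_itv/= -!ler_norml !ltW.
move=> n; split; first by apply: measurableX; exact: measurable_itv.
rewrite /sfleb2 product_measure1E//; try exact: measurable_itv.
rewrite /= lebesgue_measure_itv/=; case: ifP => _; last by rewrite mule0 ltry.
by rewrite -EFinB -EFinM ltry.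
Qed.

HB.instance Definition _ :=
  @Measure_isSigmaFinite.Build _ _ _ sfleb2 sfleb2_sigma_finite.

Lemma leb3E : leb3 R = (sfleb2 \x mu)%E :> {measure set T3 -> \bar R}.
Proof. by []. Qed.

(** Lines parallel to the axes are parametrised by the coordinate that varies:
    the slices of a function are then the one-variable functions that occur
    both in Fubini's theorem and in partial derivatives. *)
Definition upd (i : 'I_3) (x : R3 R) (t : R) : R3 R :=
  (if i == 0 then t else x.1.1, if i == 1 then t else x.1.2,
   if i == 2 then t else x.2).

(** Fubini, integrating along the lines of direction i first. *)
Lemma leb3_slice_eq0 (i : 'I_3) (f : T3 -> \bar R) :
  (leb3 R).-integrable setT f ->
  (forall x : R3 R, \int[mu]_t f (upd i x t) = 0)%E -> (\int[leb3 R]_z f z = 0)%E.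
Proof.
rewrite leb3E => fi f0.
case: i f0 => -[|[|[|//]]] ? f0.
- apply: (fubini_slice1_eq0 fi).
  apply: filterS (ae_integrable2 fi) => z fz.
  apply: (fubini_slice1_eq0 fz).
  by apply: aeW => y; exact: (f0 (0, y, z)).
- apply: (fubini_slice1_eq0 fi).
  apply: filterS (ae_integrable2 fi) => z fz.
  apply: (fubini_slice2_eq0 fz).
  by move=> x; exact: (f0 (x, 0, z)).
- apply: (fubini_slice2_eq0 fi) => -[x y]; exact: (f0 (x, y, 0)).
Qed.

(** Not immediate: the sigma-algebra is the product of the Borel ones, and is
    not defined from the open sets of the product topology. *)
Lemma continuous_measurable3 (f : R3 R -> R) : continuous f ->
  measurable_fun (setT : set T3) f.
Proof.
move=> cf.
rewrite (_ : f = fun p : (mR * mR * mR)%type =>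
    (fun (x : mR * mR) z => f (x, z)) p.1 p.2); last by apply/funext => -[].
apply: (@caratheodory_measurable R _ _
  (fun (x : (mR * mR)%type) z => f (x, z))) => [z|x].
  rewrite [X in measurable_fun _ X](_ : _ = fun p : (mR * mR)%type =>
      (fun (x : mR) y => f (x, y, z)) p.1 p.2); last by apply/funext => -[].
  apply: (@caratheodory_measurable R _ _ (fun (x : mR) y => f (x, y, z))) => [y|x].
    apply: (@continuous_measurable_fun R) => x.
    apply: (@continuous_comp _ _ _ (fun x : R => (x, y, z) : R3 R) f); last exact: cf.
    exact: (cvg_pair (cvg_pair cvg_id (cvg_cst y)) (cvg_cst z)).
  move=> y.
  apply: (@continuous_comp _ _ _ (fun y : R => (x, y, z) : R3 R) f); last exact: cf.
  exact: (cvg_pair (cvg_pair (cvg_cst x) cvg_id) (cvg_cst z)).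
move=> z.
apply: (@continuous_comp _ _ _ (fun y : R => (x, y) : R3 R) f); last exact: cf.
exact: (cvg_pair (cvg_cst x) cvg_id).
Qed.

Definition cube (k : R) : set T3 := (`[-k, k] `*` `[-k, k]) `*` `[-k, k].

Lemma measurable_cube k : measurable (cube k).
Proof.
by do 2 (apply: measurableX; last exact: measurable_itv); exact: measurable_itv.
Qed.

Lemma leb3_prod (A B C : set mR) : measurable A -> measurable B -> measurable C ->
  (leb3 R ((A `*` B) `*` C) = mu A * mu B * mu C)%E.
Proof.
move=> mA mB mC; transitivity (sfleb2 (A `*` B) * mu C)%E.
  by apply: (product_measure1E sfleb2 mu) => //; exact: measurableX.
by congr (_ * _)%E; exact: product_measure1E.
Qed.

Lemma leb3_cube k : 0 <= k -> (leb3 R (cube k) = ((k *+ 2) ^+ 3)%:E)%E.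
Proof.
move=> k0; rewrite leb3_prod//; try exact: measurable_itv.
rewrite /= lebesgue_measure_itv/= lte_fin.
case: ltP => h.
  by rewrite -EFinB -!EFinM; congr (_%:E); ring.
have -> : k = 0 by lra.
by rewrite mul0rn expr0n !mule0.
Qed.

Lemma bounded_cube_integrable (f : T3 -> R) (M k : R) :
  measurable_fun setT f -> (forall x, ~ cube k x -> f x = 0) ->
  (forall x, `|f x| <= M) -> (leb3 R).-integrable setT (EFin \o f).
Proof.
move=> mf f0 fM.
have M0 : 0 <= M by apply: le_trans (fM (0, 0, 0)).
apply: (@le_integrable _ _ _ _ _ _ _ (EFin \o (fun x => M * \1_(cube `|k|) x))) => //.
- exact/measurable_EFinP.
- move=> x _ /=; rewrite lee_fin normrM (ger0_norm M0).
  have [xk|xk] := pselect (cube k x).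
    rewrite indicE mem_set ?normr1 ?mulr1//.
    have hk := ler_norm k.
    case: xk => -[/=]; rewrite !in_itv/= => /andP[a1 a2] /andP[b1 b2] /andP[c1 c2].
    by split; [split|]; rewrite /= in_itv/=; apply/andP; split; lra.
  by rewrite f0// normr0 mulr_ge0.
- apply/integrableP; split.
    apply/measurable_EFinP; apply: measurable_funM => //.
    by apply: measurable_indic; exact: measurable_cube.
  under eq_integral do rewrite /= ger0_norm ?mulr_ge0// EFinM.
  rewrite ge0_integralZl//; last first.
    by apply/measurable_EFinP; apply: measurable_indic; exact: measurable_cube.
  rewrite integral_indic//; last exact: measurable_cube.
  by rewrite setIT leb3_cube// -EFinM ltry.
Qed.

End leb3_facts.

(** * Symmetry of mixed partial derivatives *)

Section schwarz.
Variable R : realType.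

(** The mean value theorem for s |-> f s (b + h) - f s b, and then for one of
    the functions fs xi. *)
Lemma mixed_difference_mvt (f fs fst : R -> R -> R) (a b h : R) : 0 < h ->
  (forall s t : R, is_derive s 1 (f ^~ t) (fs s t)) ->
  (forall s t : R, is_derive t 1 (fs s) (fst s t)) ->
  exists xi eta : R, [/\ `|a - xi| <= h, `|b - eta| <= h &
    f (a + h) (b + h) - f (a + h) b - f a (b + h) + f a b = fst xi eta * h * h].
Proof.
move=> h0 fD fsD.
have ah : a <= a + h by rewrite lerDl ltW.
have bh : b <= b + h by rewrite lerDl ltW.
have gD (s : R) : is_derive s 1 (fun s => f s (b + h) - f s b) (fs s (b + h) - fs s b).
  by apply: is_deriveB.
have contD (g g' : R -> R) (c d : R) : (forall s : R, is_derive s 1 g (g' s)) ->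
    {within `[c, d], continuous g}.
  move=> gg; apply: derivable_within_continuous => x _.
  by have [] := gg x.
have [xi + E1] := MVT_segment ah (fun x _ => gD x) (contD _ _ _ _ gD).
rewrite in_itv/= => /andP[xi1 xi2].
have [eta + E2] := MVT_segment bh (fun x _ => fsD xi x) (contD _ _ _ _ (fsD xi)).
rewrite in_itv/= => /andP[eta1 eta2].
exists xi, eta; split.
- by rewrite ler_norml; apply/andP; split; lra.
- by rewrite ler_norml; apply/andP; split; lra.
- move: E1; rewrite E2 [a + h - a]addrC addKr [b + h - b]addrC addKr => <-; ring.
Qed.

(** The second difference of f over a square of side h is h ^+ 2 times either
    mixed derivative, each at some point of the square; by continuity the two
    derivatives agree when h tends to 0. *)
Lemma mixed_derivatives_eq (f fs ft fst fts : R -> R -> R) (a b : R) :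
  (forall s t : R, is_derive s 1 (f ^~ t) (fs s t)) ->
  (forall s t : R, is_derive t 1 (f s) (ft s t)) ->
  (forall s t : R, is_derive t 1 (fs s) (fst s t)) ->
  (forall s t : R, is_derive s 1 (ft ^~ t) (fts s t)) ->
  {for (a, b), continuous (fun p : R * R => fst p.1 p.2)} ->
  {for (a, b), continuous (fun p : R * R => fts p.1 p.2)} ->
  fst a b = fts a b.
Proof.
move=> fD1 fD2 fD12 fD21 c1 c2.
apply/eqP; rewrite -subr_eq0 -normr_le0; apply/ler_addgt0Pl => e e0.
rewrite addr0.
have e20 : 0 < e / 2 by rewrite divr_gt0.
move/cvgrPdist_le: c1 => /(_ _ e20) [[/= A B] [nA nB] AB].
move/cvgrPdist_le: c2 => /(_ _ e20) [[/= C D] [nC nD] CD].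
have : \forall h \near 0^'+, 0 < h /\
   (forall s, `|a - s| <= h -> A s /\ C s) /\ (forall t, `|b - t| <= h -> B t /\ D t).
  have /nbhs_ballP[d1 /= d10 H1] : nbhs a (A `&` C) by apply: filterI.
  have /nbhs_ballP[d2 /= d20 H2] : nbhs b (B `&` D) by apply: filterI.
  near=> h; split; [by []|split => s sh].
    apply: H1; rewrite /ball/=; apply: le_lt_trans sh _.
    by near: h; exact: nbhs_right_lt.
  apply: H2; rewrite /ball/=; apply: le_lt_trans sh _.
  by near: h; exact: nbhs_right_lt.
move=> /filter_ex[h [h0 [HA HB]]].
have [x1 [y1 [x1h y1h E1]]] := mixed_difference_mvt a b h0 fD1 fD12.
have [y2 [x2 [y2h x2h E2]]] := @mixed_difference_mvt (fun t s => f s t)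
   (fun t s => ft s t) (fun t s => fts s t) b a h h0 (fun t s => fD2 s t) (fun t s => fD21 s t).
have E : fst x1 y1 = fts x2 y2.
  have hh : h * h != 0 by rewrite mulf_neq0// gt_eqF.
  by apply: (mulIf hh); rewrite !mulrA -E1 -E2; ring.
have := AB (x1, y1) (conj (HA _ x1h).1 (HB _ y1h).1).
have := CD (x2, y2) (conj (HA _ x2h).2 (HB _ y2h).2).
rewrite /= E => h1 h2.
rewrite (_ : fst a b - fts a b = (fst a b - fts x2 y2) - (fts a b - fts x2 y2));
  last by ring.
by rewrite (le_trans (ler_normB _ _))//; lra.
Unshelve. all: by end_near. Qed.

End schwarz.

Section slices.
Variable R : realType.
Implicit Types (x : R3 R) (i j : 'I_3).

Definition coor i x : R := if i == 0 then x.1.1 else if i == 1 then x.1.2 else x.2.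

Lemma ord3P i : [\/ i = 0, i = 1 | i = 2].
Proof.
by case: i => -[|[|[|//]]] p; [apply: Or31|apply: Or32|apply: Or33]; apply/val_inj.
Qed.

Lemma upd_coor i x : upd i x (coor i x) = x.
Proof. by case: x => -[x y] z; have [->|->|->] := ord3P i. Qed.

Lemma coor_upd i x t : coor i (upd i x t) = t.
Proof. by case: x => -[x y] z; have [->|->|->] := ord3P i. Qed.

Lemma upd_upd i x s t : upd i (upd i x s) t = upd i x t.
Proof. by case: x => -[x y] z; have [->|->|->] := ord3P i. Qed.

Lemma updC i j x s t : i != j -> upd i (upd j x s) t = upd j (upd i x t) s.
Proof.
by case: x => -[x y] z; have [->|->|->] := ord3P i; have [->|->|->] := ord3P j.
Qed.

Lemma basis3_line i x (h : R) : h *: basis3 R i + x = upd i x (h *: 1 + coor i x).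
Proof.
case: x => -[x y] z; rewrite /basis3 /upd /coor.
by have [->|->|->] := ord3P i; congr (_, _, _);
  rewrite /= /GRing.scale/= ?mulr1 ?mulr0 ?add0r.
Qed.

(** Equality of the difference quotients themselves, which transfers both
    derivability and derivatives between a function and its slices. *)
Lemma slice_quotient i (f : R3 R -> R) x :
  (fun h => h^-1 *: ((f \o shift x) (h *: basis3 R i) - f x)) =
  (fun h => h^-1 *: (((fun t => f (upd i x t)) \o shift (coor i x)) (h *: 1) -
                     f (upd i x (coor i x)))).
Proof.
by apply/funext => h; rewrite upd_coor/= basis3_line.
Qed.

Lemma derivable_slice i (f : R3 R -> R) x :
  derivable f x (basis3 R i) <-> derivable (fun t => f (upd i x t)) (coor i x) 1.
Proof. by rewrite /derivable slice_quotient. Qed.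

Lemma partial_slice i (f : R3 R -> R) x :
  partial i f x = derive1 (fun t => f (upd i x t)) (coor i x).
Proof. by rewrite derive1E /partial /derive slice_quotient. Qed.

Lemma is_derive_slice i (f : R3 R -> R) x (s : R) :
  (forall y, derivable f y (basis3 R i)) ->
  is_derive s 1 (fun t => f (upd i x t)) (partial i f (upd i x s)).
Proof.
move=> df.
have E : (fun t => f (upd i (upd i x s) t)) = (fun t => f (upd i x t)).
  by apply/funext => t; rewrite upd_upd.
rewrite partial_slice coor_upd derive1E E.
apply: derivableP.
by have /derivable_slice := df (upd i x s); rewrite coor_upd E.
Qed.

Lemma continuous_coor i : continuous (coor i).
Proof.
move=> x; rewrite /coor; have [->|->|->] := ord3P i => /=.
- by apply: (@continuous_comp _ _ _ (fun x : R3 R => x.1) fst); exact: cvg_fst.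
- apply: (@continuous_comp _ _ _ (fun x : R3 R => x.1) snd).
    exact: cvg_fst.
  exact: cvg_snd.
- exact: cvg_snd.
Qed.

Lemma continuous_upd i x : continuous (upd i x).
Proof.
case: x => -[x y] z t; rewrite /upd.
have [->|->|->] := ord3P i => /=.
- exact: (cvg_pair (cvg_pair cvg_id (cvg_cst y)) (cvg_cst z)).
- exact: (cvg_pair (cvg_pair (cvg_cst x) cvg_id) (cvg_cst z)).
- exact: (cvg_pair (cvg_pair (cvg_cst x) (cvg_cst y)) cvg_id).
Qed.

Lemma continuous_upd2 i j x : continuous (fun p : R * R => upd j (upd i x p.1) p.2).
Proof.
have C (f g h : R * R -> R) : continuous f -> continuous g -> continuous h ->
    continuous (fun p => (f p, g p, h p) : R3 R).
  by move=> cf cg ch p; exact: (cvg_pair (cvg_pair (cf p) (cg p)) (ch p)).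
by rewrite /upd; apply: C => p /=;
  (case: (j == _); [exact: cvg_snd|]);
  (case: (i == _); [exact: cvg_fst|exact: cvg_cst]).
Qed.

Lemma partialC i j (f : R3 R -> R) x : Ck 2 f ->
  partial i (partial j f) x = partial j (partial i f) x.
Proof.
move=> C2; have [->//|ij] := eqVneq i j.
have d1 k y : derivable f y (basis3 R k) by have [] := C2 k.
have d2 k l y : derivable (partial k f) y (basis3 R l) by have [_ /(_ l)[]] := C2 k.
have c2 k l : continuous (partial l (partial k f)) by have [_ /(_ l)[]] := C2 k.
have ji : j != i by rewrite eq_sym.
have ux : upd j (upd i x (coor i x)) (coor j x) = x by rewrite updC// !upd_coor.
rewrite -[in LHS]ux -[in RHS]ux.
have U s t : upd j (upd i x s) t = upd i (upd j x t) s by rewrite (updC _ _ _ ij).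
have UE (g : R3 R -> R) t :
    (fun s => g (upd j (upd i x s) t)) = (fun s => g (upd i (upd j x t) s)).
  by apply/funext => s; rewrite U.
apply/esym.
apply: (@mixed_derivatives_eq R (fun s t => f (upd j (upd i x s) t))
  (fun s t => partial i f (upd j (upd i x s) t))
  (fun s t => partial j f (upd j (upd i x s) t))
  (fun s t => partial j (partial i f) (upd j (upd i x s) t))
  (fun s t => partial i (partial j f) (upd j (upd i x s) t))).
- by move=> s t; rewrite UE U; exact: is_derive_slice.
- by move=> s t; exact: is_derive_slice.
- by move=> s t; exact: is_derive_slice.
- by move=> s t; rewrite UE U; exact: is_derive_slice.
- apply: continuous_comp; [exact: continuous_upd2|exact: c2].
- apply: continuous_comp; [exact: continuous_upd2|exact: c2].
Qed.

End slices.

(** * Integration by parts against a tent *)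

Section tent.
Variable R : realType.
Local Notation mu := (@lebesgue_measure R).

Definition tent (a t : R) : R := Num.max 0 (a - `|t|).
(** Minus the derivative of [tent a]. The value 1 at 0 makes [dtent a] equal to
    1 or -1 on the whole of ]-a, a[. *)
Definition dtent (a t : R) : R :=
  if `|t| < a then (if t <= 0 then 1 else -1) else 0.

(** The integrand is the derivative of t |-> (al + c * t) * g t. *)
Lemma integral_affine_by_parts (g g' : R -> R) (al c x y : R) : x < y ->
  (forall t : R, is_derive t 1 g (g' t)) -> continuous g' ->
  (\int[mu]_(t in `[x, y]) (c * g t + (al + c * t) * g' t)%:E =
   ((al + c * y) * g y - (al + c * x) * g x)%:E)%E.
Proof.
move=> xy gD cg'.
pose F t := (al + c * t) * g t.
have FD (t : R) : is_derive t 1 F (c * g t + (al + c * t) * g' t).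
  have D1 : is_derive t 1 (cst al + c \*: @id R) (0 + c *: 1).
    exact: is_deriveD.
  have D := is_deriveM D1 (gD t).
  rewrite (_ : F = (cst al + c \*: @id R) * g)//.
  apply: (is_derive_eq D).
  by rewrite /GRing.scale/= add0r mulr1 addrC; congr (_ + _); rewrite mulrC.
have cg : continuous g.
  move=> t; apply/differentiable_continuous/derivable1_diffP.
  by have [] := gD t.
have cF : continuous F.
  move=> t; apply/differentiable_continuous/derivable1_diffP.
  by have [] := FD t.
rewrite (@continuous_FTC2 _ _ F)//.
- apply: continuous_subspaceT => t; apply: cvgD.
    by apply: cvgM; [exact: cvg_cst|exact: cg].
  apply: cvgM; last exact: cg'.
  by apply: cvgD; [exact: cvg_cst|apply: cvgM; [exact: cvg_cst|exact: cvg_id]].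
- split.
  + by move=> t _; have [] := FD t.
  + exact/cvg_at_right_filter/cF.
  + exact/cvg_at_left_filter/cF.
- by move=> t _; rewrite derive1E; have [_ ->] := FD t.
Qed.

(** On each side of 0 the tent is affine; the boundary terms at 0 of the two
    sides cancel, and those at a and -a vanish with the tent. *)
Lemma tent_by_parts (a : R) (g g' : R -> R) :
  (forall t : R, is_derive t 1 g (g' t)) -> continuous g' ->
  (\int[mu]_t (dtent a t * g t + tent a t * g' t)%:E = 0)%E.
Proof.
move=> gD cg'.
have [a0|a0] := leP a 0.
  apply: integral0_eq => t _; have ta : a <= `|t| by rewrite (le_trans a0).
  by rewrite /dtent ltNge ta/= mul0r add0r /tent max_l ?subr_le0// mul0r.
have cg : continuous g.
  move=> t; apply/differentiable_continuous/derivable1_diffP.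
  by have [] := gD t.
pose k t := dtent a t * g t + tent a t * g' t.
have mk1 (c : R) : measurable_fun setT (fun t => c * g t + (a + c * t) * g' t).
  apply: continuous_measurable_fun => t; apply: cvgD.
    by apply: cvgM; [exact: cvg_cst|exact: cg].
  apply: cvgM; last exact: cg'.
  by apply: cvgD; [exact: cvg_cst|apply: cvgM; [exact: cvg_cst|exact: cvg_id]].
have kl t : t \in `]-a, 0] -> k t = 1 * g t + (a + 1 * t) * g' t.
  rewrite in_itv/= => /andP[t1 t2].
  rewrite /k /dtent /tent ler0_norm// ltrNl t1 t2 opprK.
  by rewrite max_r ?mul1r//; lra.
have kr t : t \in `]0, a[ -> k t = (-1) * g t + (a + (-1) * t) * g' t.
  rewrite in_itv/= => /andP[t1 t2]; rewrite /k /dtent /tent gtr0_norm// t2 leNgt t1/=.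
  by rewrite max_r ?mulN1r//; lra.
have k0 t : t \notin `]-a, a[ -> k t = 0.
  move=> ta; rewrite /k /dtent /tent.
  have -> : (`|t| < a) = false by apply/negbTE; move: ta; rewrite in_itv/= -ltr_norml.
  rewrite mul0r add0r max_l ?mul0r// subr_le0 leNgt.
  by move: ta; rewrite in_itv/= -ltr_norml.
pose S := `]-a, a[%classic : set R.
have -> : (\int[mu]_t (k t)%:E = \int[mu]_(t in S) (k t)%:E)%E.
  rewrite [RHS]integral_mkcond; apply: eq_integral => t _.
  rewrite patchE; case: ifPn => // /negP ta.
  by rewrite k0//; apply/negP => h; apply: ta; rewrite inE.
have mkl : measurable_fun (`]-a, 0] : set R) k.
  apply: (@eq_measurable_fun _ _ _ _ _ (fun t => 1 * g t + (a + 1 * t) * g' t)).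
    by move=> t; rewrite inE/= => /kl ->.
  exact: measurable_funTS.
have mkr : measurable_fun (`]0, a[ : set R) k.
  apply: (@eq_measurable_fun _ _ _ _ _ (fun t => (-1) * g t + (a + (-1) * t) * g' t)).
    by move=> t; rewrite inE/= => /kr ->.
  exact: measurable_funTS.
have -> : (S = `]-a, 0] `|` `]0, a[ :> set R)%classic.
  by rewrite /S -itv_bndbnd_setU// bnd_simp//; lra.
rewrite integral_setU//=; last 2 first.
- by apply/measurable_EFinP/measurable_funU; [exact: measurable_itv|exact: measurable_itv|split].
- apply/disj_setPS => t [/=]; rewrite !in_itv/= => /andP[_ h] /andP[h' _].
  by have := lt_le_trans h' h; rewrite ltxx.
rewrite (@eq_integral _ _ _ mu _
    (fun t => (1 * g t + (a + 1 * t) * g' t)%:E));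
  last by move=> t; rewrite inE/= => /kl ->.
rewrite [X in (_ + X)%E](@eq_integral _ _ _ mu _
    (fun t => ((-1) * g t + (a + (-1) * t) * g' t)%:E));
  last by move=> t; rewrite inE/= => /kr ->.
rewrite integral_itv_obnd_cbnd; last first.
  by apply/measurable_EFinP; apply: measurable_funTS; exact: mk1.
rewrite integral_itv_obnd_cbnd; last first.
  by apply/measurable_EFinP; apply: measurable_funTS; exact: mk1.
rewrite integral_itv_bndo_bndc; last first.
  by apply/measurable_EFinP; apply: measurable_funTS; exact: mk1.
rewrite !integral_affine_by_parts//; last by lra.
by rewrite -EFinD; congr (_%:E); ring.
Qed.

End tent.

(** * Smooth functions of one variable that vanish on a half-line *)

Section smooth1d.
Variable R : realType.
Implicit Types (f g : R -> R) (p q : {poly R}).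

Fixpoint Ck1 (k : nat) (f : R -> R) : Prop :=
  match k with
  | 0 => continuous f
  | k'.+1 => (forall x, derivable f x 1) /\ Ck1 k' (derive1 f)
  end.

Lemma derivable_continuous1 f : (forall x, derivable f x 1) -> continuous f.
Proof. by move=> df x; apply/differentiable_continuous/derivable1_diffP. Qed.

Lemma Ck1S k f : Ck1 k.+1 f -> Ck1 k f.
Proof.
elim: k f => [|k IH] f; first by case=> /derivable_continuous1.
by move=> [df /IH]; split.
Qed.

Lemma Ck1D k f g : Ck1 k f -> Ck1 k g -> Ck1 k (f \+ g).
Proof.
elim: k f g => [|k IH] f g /=.
  by move=> cf cg x; apply: cvgD; [exact: cf|exact: cg].
move=> [df cf] [dg cg]; split; first by move=> x; exact: derivableD.
rewrite (_ : derive1 _ = derive1 f \+ derive1 g); first exact: IH.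
by apply/funext => x; rewrite /= !derive1E; exact: deriveD.
Qed.

Lemma Ck1M k f g : Ck1 k f -> Ck1 k g -> Ck1 k (f \* g).
Proof.
elim: k f g => [|k IH] f g /=.
  by move=> cf cg x; apply: cvgM; [exact: cf|exact: cg].
move=> [df cf] [dg cg]; split; first by move=> x; exact: derivableM.
rewrite (_ : derive1 _ = (f \* derive1 g) \+ (g \* derive1 f)).
  by apply: Ck1D; apply: IH => //; exact: Ck1S.
by apply/funext => x; rewrite /= !derive1E; exact: deriveM.
Qed.

Lemma Ck1Z k (c : R) f : Ck1 k f -> Ck1 k (fun x => c * f x).
Proof.
elim: k f => [|k IH] f /=.
  by move=> cf x; apply: cvgM; [exact: cvg_cst|exact: cf].
move=> [df cf]; split; first by move=> x; exact: (@derivableZ _ _ _ f c).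
rewrite (_ : derive1 _ = (fun x => c * derive1 f x)); first exact: IH.
by apply/funext => x; rewrite /= !derive1E; exact: (@deriveZ _ _ _ f c).
Qed.

Lemma Ck1_affine k (a b : R) f : Ck1 k f -> Ck1 k (fun x => f (a * x + b)).
Proof.
have D (x : R) : is_derive x 1 (fun x => a * x + b) a.
  have D1 : is_derive x 1 (a \*: @id R + cst b) (a *: 1 + 0) by exact: is_deriveD.
  by apply: (is_derive_eq D1); rewrite /GRing.scale/= addr0 mulr1.
have Dd x : derivable (fun x => a * x + b) x 1 by have [] := D x.
elim: k f => [|k IH] f /=.
  by move=> cf x; apply: continuous_comp; [exact: (derivable_continuous1 Dd)|exact: cf].
move=> [df cf]; split.
  move=> x; apply/derivable1_diffP; apply: differentiable_comp; exact/derivable1_diffP.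
rewrite (_ : derive1 _ = (fun x => a * derive1 f (a * x + b))); first exact/Ck1Z/IH.
apply/funext => x; rewrite derive1_comp// mulrC; congr (_ * _).
by rewrite derive1E; have [_ ->] := D x.
Qed.

(** For p = 1 this is the classical smooth function that vanishes for t <= 0;
    the polynomial factor makes the family stable under derivation. *)
Definition flat p (t : R) : R := if 0 < t then p.[t^-1] * expR (- t^-1) else 0.

(** The powers of 1 / t are dominated by exp (1 / t), with one factor t to
    spare; this linear bound gives both continuity and derivability at 0. *)
Lemma flat_bound p : exists2 C : R, 0 <= C & forall t : R, `|flat p t| <= C * `|t|.
Proof.
exists (\sum_(i < size p) `|p`_i| * (i.+1)`!%:R).
  by apply: sumr_ge0 => i _; rewrite mulr_ge0.
move=> t; rewrite /flat; case: ifPn => t0; last first.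
  by rewrite normr0 mulr_ge0// sumr_ge0// => i _; rewrite mulr_ge0.
rewrite horner_coef mulr_suml mulr_suml (gtr0_norm t0).
apply: le_trans (ler_norm_sum _ _ _) _; apply: ler_sum => i _.
have s0 : 0 < t^-1 by rewrite invr_gt0.
rewrite -mulrA normrM -mulrA ler_wpM2l//.
rewrite expRN normrM normfV !gtr0_norm ?exprn_gt0 ?expR_gt0//.
rewrite ler_pdivrMr ?expR_gt0// -mulrA -ler_pdivrMl ?ltr0n ?fact_gt0//.
rewrite -ler_pdivrMl//.
apply: le_trans (expR_ge1Dxn i (ltW s0)); rewrite -[leLHS]add0r lerD//.
by rewrite exprS -mulrA [_ ^+ i / _]mulrC.
Qed.

(** Away from 0 this is the chain rule; at 0 the difference quotient is the
    function of the same family with p replaced by 'X * p. *)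
Lemma flat_derive p (x : R) : is_derive x 1 (flat p) (flat ('X^2 * (p - p^`())) x).
Proof.
have [x0|x0|->] := ltgtP x 0.
- have -> : flat ('X^2 * (p - p^`())) x = 0 by rewrite /flat ltNge ltW.
  apply: (@near_eq_is_derive _ _ _ (cst 0)).
  near=> t; rewrite /flat ifF//; apply/negbTE; rewrite -leNgt ltW//.
  near: t; exact: lt_nbhsl.
- have xn0 : x != 0 by rewrite gt_eqF.
  have -> : flat ('X^2 * (p - p^`())) x = ('X^2 * (p - p^`())).[x^-1] * expR (- x^-1).
    by rewrite /flat x0.
  apply: (@near_eq_is_derive _ _ _ (fun t : R => p.[t^-1] * expR (- t^-1))).
    near=> t; rewrite /flat ifT//.
    near: t; exact: lt_nbhsr.
  have Di : is_derive x 1 (fun t : R => t^-1) (- x^-2 *: 1) by exact: is_deriveV.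
  have Dp := is_derive1_comp (is_derive_poly p x^-1) Di.
  have De : is_derive x 1 (expR \o (fun t : R => - t^-1))
      (expR (- x^-1) * - (- x^-2 *: 1)).
    by apply: is_derive1_comp.
  apply: (is_derive_eq (is_deriveM Dp De)).
  rewrite hornerM hornerXn hornerD hornerN -exprVn /= /GRing.scale /=; ring.
- have -> : flat ('X^2 * (p - p^`())) 0 = 0 by rewrite /flat ltxx.
  have H : h^-1 *: ((flat p \o shift 0) (h *: 1) - flat p 0) @[h --> 0^'] --> (0 : R).
    rewrite [X in X @ _ --> _](_ : _ = flat ('X * p)); last first.
      apply/funext => h; rewrite /GRing.scale/= mulr1 addr0 /flat ltxx subr0.
      by case: ifPn => h0; rewrite ?mulr0// hornerM hornerX mulrA.
    have [C C0 HC] := flat_bound ('X * p).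
    have C1 : 0 < C + 1 by rewrite ltr_wpDl.
    apply/cvgrPdist_lt => e e0; near=> t.
    rewrite sub0r normrN (le_lt_trans (HC t))//.
    apply: (@le_lt_trans _ _ ((C + 1) * `|t|)); first by rewrite ler_wpM2r// lerDl.
    rewrite mulrC -ltr_pdivlMr//.
    near: t; exact: (dnbhs0_lt (divr_gt0 e0 C1)).
  apply: DeriveDef; first by apply/cvg_ex; exists 0.
  by apply/cvg_lim.
Unshelve. all: by end_near. Qed.

Lemma flat_smooth k p : Ck1 k (flat p).
Proof.
elim: k p => [|k IH] p /=.
  by apply: derivable_continuous1 => x; have [] := flat_derive p x.
split; first by move=> x; have [] := flat_derive p x.
rewrite (_ : derive1 _ = flat ('X^2 * (p - p^`()))) //.
by apply/funext => x; rewrite derive1E; have [_ ->] := flat_derive p x.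
Qed.
End smooth1d.

(** * Integrable functions with zero integral over all boxes *)

Section dynkin_integral.
Local Open Scope ereal_scope.
Context d1 d2 (T : measurableType d1) (S : measurableType d2) (R : realType).
Variables (mu : {measure set T -> \bar R}) (f : T -> \bar R).
Hypothesis fi : mu.-integrable setT f.

(** The sets A over which the integral in the conclusion vanishes form a Dynkin
    system: the complement of A is handled by the hypothesis on W, disjoint
    unions by sigma-additivity. *)
Lemma dynkin_integral_eq0 (G : set_system S) (W : set T) (X : T -> S) :
  @measurable _ S = <<s G >> -> setI_closed G ->
  measurable W -> measurable_fun setT X ->
  \int[mu]_(x in W) f x = 0 ->
  (forall A, G A -> \int[mu]_(x in W `&` X @^-1` A) f x = 0) ->
  forall A, measurable A -> \int[mu]_(x in W `&` X @^-1` A) f x = 0.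
Proof.
move=> SG GI mW mX W0 G0 A mA.
have mXI (B : set S) : measurable B -> measurable (W `&` X @^-1` B).
  by move=> mB; apply: measurableI => //; rewrite -[X in measurable X]setTI; exact: mX.
apply: (@dynkin_induction _ S G
  (fun A => \int[mu]_(x in W `&` X @^-1` A) f x = 0)) => //.
- by rewrite preimage_setT setIT.
- move=> B mB B0.
  have mf : measurable_fun W f.
    by apply: measurable_funTS; exact: measurable_int fi.
  have E : W = (W `&` X @^-1` B) `|` (W `&` X @^-1` (~` B)).
    by rewrite -setIUr preimage_setC setUv setIT.
  have := W0; rewrite [in X in X -> _]E integral_setU//.
  + by rewrite B0 add0e.
  + exact: mXI.
  + by apply: mXI; exact: measurableC.
  + by rewrite -E.
  + by apply/disj_setPS => x [[_ Bx] [_ nBx]].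
- move=> F mF tF F0.
  rewrite preimage_bigcup setI_bigcupr integral_bigcup//.
  + by apply: eseries0 => i _ _; exact: F0.
  + move=> i j _ _ [x [[_ Fi] [_ Fj]]]; apply: (tF i j) => //; by exists (X x).
  + by move=> k; exact: mXI.
  + apply: integrableS fi => //; apply: bigcup_measurable => k _; exact: mXI.
- by rewrite -SG.
Qed.

End dynkin_integral.

Section boxes.
Variable R : realType.
Local Notation mR := (measurableTypeR R).
Local Notation mu := (@lebesgue_measure R).
Local Notation T3 := (mR * mR * mR)%type.

Definition obox (a b : R3 R) : set T3 :=
  (`]a.1.1, b.1.1[ `*` `]a.1.2, b.1.2[) `*` `]a.2, b.2[.

Lemma measurable_obox a b : measurable (obox a b).
Proof.
by do 2 (apply: measurableX; last exact: measurable_itv); exact: measurable_itv.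
Qed.

Lemma setI_oo (x y z w : R) :
  `]x, y[%classic `&` `]z, w[%classic =
  `](Num.max x z), (Num.min y w)[%classic :> set R.
Proof.
apply/seteqP; split => t /=; rewrite !in_itv/= gt_max lt_min.
  by move=> [/andP[-> ->] /andP[-> ->]].
by move=> /andP[/andP[-> ->] /andP[-> ->]].
Qed.

Lemma oboxI a b c d : obox a b `&` obox c d =
  obox (Num.max a.1.1 c.1.1, Num.max a.1.2 c.1.2, Num.max a.2 c.2)
       (Num.min b.1.1 d.1.1, Num.min b.1.2 d.1.2, Num.min b.2 d.2).
Proof. by rewrite /obox -!setXI !setI_oo. Qed.

Lemma measurable_open_intervals : @measurable _ mR = <<s @RGenOpens.G R >>.
Proof. exact: RGenOpens.measurableE. Qed.

Lemma setI_closed_open_intervals : setI_closed (@RGenOpens.G R).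
Proof.
move=> _ _ [x [y ->]] [z [w ->]]; rewrite setI_oo.
by exists (Num.max x z), (Num.min y w).
Qed.

Lemma setI_closed_rectangles d1 d2 (T1 : measurableType d1) (T2 : measurableType d2) :
  setI_closed ([set A `*` B | A in @measurable d1 T1 & B in @measurable d2 T2]).
Proof.
move=> _ _ [A mA [B mB <-]] [C mC [D mD <-]].
exists (A `&` C); first exact: measurableI.
by exists (B `&` D); [exact: measurableI|rewrite setXI].
Qed.

(** Open intervals are replaced by arbitrary measurable sets one coordinate at a
    time, then rectangles by measurable sets of the plane, and finally
    rectangles over the plane by measurable sets of the space. Since f vanishes
    outside a box, slabs that are unbounded in one direction count as boxes,
    which provides the starting point of each Dynkin argument. *)
Lemma integral_oboxes_eq0 (f : T3 -> \bar R) (k : R) :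
  (leb3 R).-integrable setT f ->
  (forall x, ~ obox (-k, -k, -k) (k, k, k) x -> f x = 0%E) ->
  (forall a b, \int[leb3 R]_(x in obox a b) f x = 0)%E ->
  forall A, measurable A -> (\int[leb3 R]_(x in A) f x = 0)%E.
Proof.
move=> fi fk f0.
pose Q := obox (-k, -k, -k) (k, k, k).
have fW (A : set T3) : (\int[leb3 R]_(x in A) f x =
    \int[leb3 R]_(x in A `&` Q) f x)%E.
  rewrite [RHS]integral_mkcondr; apply: eq_integral => x _; rewrite patchE.
  by case: ifPn => // /negP xk; rewrite fk// => h; apply: xk; rewrite inE.
have m1 : measurable_fun setT (fun x : T3 => x.1.1).
  by apply: (measurableT_comp measurable_fst); exact: measurable_fst.
have m2 : measurable_fun setT (fun x : T3 => x.1.2).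
  by apply: (measurableT_comp measurable_snd); exact: measurable_fst.
have m3 : measurable_fun setT (fun x : T3 => x.2) by exact: measurable_snd.
have mI (x y : R) : measurable (`]x, y[%classic : set mR) by exact: measurable_itv.
pose D := @dynkin_integral_eq0 _ _ _ _ _ (leb3 R) f fi.
pose J : set mR := `]-k, k[%classic.
have mJ : measurable J by exact: measurable_itv.
have oI (W1 W2 W3 : set mR) : (\int[leb3 R]_(x in (W1 `*` W2) `*` W3) f x)%E =
  (\int[leb3 R]_(x in ((W1 `&` J) `*` (W2 `&` J)) `*` (W3 `&` J)) f x)%E.
  by rewrite fW /Q /obox/= -!setXI.
have step1 (A B C : set mR) : RGenOpens.G B -> RGenOpens.G C -> measurable A ->
    (\int[leb3 R]_(x in (A `*` B) `*` C) f x = 0)%E.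
  move=> [b [b' ->]] [c [c' ->]] mA.
  rewrite [X in integral _ X _](_ : _ =
    ((setT `*` `]b, b'[%classic) `*` `]c, c'[%classic) `&`
    (fun x : T3 => x.1.1) @^-1` A); last first.
    by apply/seteqP; split => -[[x y] z] /=; tauto.
  apply: (D _ mR _ _ _ measurable_open_intervals setI_closed_open_intervals) => //.
  - by do 2 apply: measurableX => //.
  - rewrite oI setTI /J !setI_oo.
    exact: (f0 (-k, Num.max b (-k), Num.max c (-k)) (k, Num.min b' k, Num.min c' k)).
  - move=> _ [a [a' ->]].
    rewrite [X in integral _ X _](_ : _ = obox (a, b, c) (a', b', c')); first exact: f0.
    by rewrite /obox; apply/seteqP; split => -[[x y] z] /=; tauto.
have step2 (A B C : set mR) : measurable A -> RGenOpens.G C -> measurable B ->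
    (\int[leb3 R]_(x in (A `*` B) `*` C) f x = 0)%E.
  move=> mA CG mB.
  have mC : measurable C by case: CG => c [c' ->].
  rewrite [X in integral _ X _](_ : _ =
    ((A `*` setT) `*` C) `&` (fun x : T3 => x.1.2) @^-1` B); last first.
    by apply/seteqP; split => -[[x y] z] /=; tauto.
  apply: (D _ mR _ _ _ measurable_open_intervals setI_closed_open_intervals) => //.
  - by do 2 apply: measurableX => //.
  - case: CG => c [c' ->]; rewrite oI setTI; apply: step1 => //.
    + by exists (-k), k.
    + by rewrite /J setI_oo; eexists; eexists.
    + exact: measurableI.
  - move=> B' B'G.
    rewrite [X in integral _ X _](_ : _ = (A `*` B') `*` C); first exact: step1.
    by apply/seteqP; split => -[[x y] z] /=; tauto.
have step3 (A B C : set mR) : measurable A -> measurable B -> measurable C ->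
    (\int[leb3 R]_(x in (A `*` B) `*` C) f x = 0)%E.
  move=> mA mB mC.
  rewrite [X in integral _ X _](_ : _ =
    ((A `*` B) `*` setT) `&` (fun x : T3 => x.2) @^-1` C); last first.
    by apply/seteqP; split => -[[x y] z] /=; tauto.
  apply: (D _ mR _ _ _ measurable_open_intervals setI_closed_open_intervals) => //.
  - by do 2 apply: measurableX => //.
  - rewrite oI setTI; apply: step2.
    + exact: measurableI.
    + by exists (-k), k.
    + exact: measurableI.
  - move=> C' C'G.
    rewrite [X in integral _ X _](_ : _ = (A `*` B) `*` C'); first exact: step2.
    by apply/seteqP; split => -[[x y] z] /=; tauto.
have step4 (P : set (mR * mR)%type) (C : set mR) : measurable P -> measurable C ->
    (\int[leb3 R]_(x in P `*` C) f x = 0)%E.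
  move=> mP mC.
  rewrite [X in integral _ X _](_ : _ =
    (setT `*` C) `&` (fun x : T3 => x.1) @^-1` P); last first.
    by apply/seteqP; split => -[[x y] z] /=; tauto.
  apply: (D _ (mR * mR)%type _ _ _ (measurable_prod_measurableType mR mR)
    (@setI_closed_rectangles _ _ mR mR)) => //.
  - exact: measurableX.
  - exact: measurable_fst.
  - by rewrite -setXTT; exact: step3.
  - move=> _ [A mA [B mB <-]].
    rewrite [X in integral _ X _](_ : _ = (A `*` B) `*` C); first exact: step3.
    by apply/seteqP; split => -[[x y] z] /=; tauto.
move=> A mA.
rewrite -[A]setTI -[X in _ `&` X]preimage_id.
apply: (D _ T3 _ _ _ (measurable_prod_measurableType (mR * mR)%type mR)
    (@setI_closed_rectangles _ _ (mR * mR)%type mR)) => //.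
- by rewrite -setXTT; exact: step4.
- by move=> _ [P mP [C mC <-]]; rewrite setTI preimage_id; exact: step4.
Qed.

End boxes.

(** * Smooth functions approximating indicators of boxes *)

Section cutoffs.
Variable R : realType.
Local Notation mR := (measurableTypeR R).
Local Notation T3 := (mR * mR * mR)%type.

(** With separated variables a partial derivative acts on one factor only. *)
Definition tensor (f g h : R -> R) (x : R3 R) : R := f x.1.1 * g x.1.2 * h x.2.

Lemma Ck1_continuous k (f : R -> R) : Ck1 k f -> continuous f.
Proof. by elim: k => [//|k IH] /Ck1S. Qed.

Lemma continuous_tensor (f g h : R -> R) :
  continuous f -> continuous g -> continuous h -> continuous (tensor f g h).
Proof.
move=> cf cg ch x; rewrite /tensor; apply: cvgM; [apply: cvgM|].
- apply: (@continuous_comp _ _ _ (coor 0) f); last exact: cf.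
  exact: (@continuous_coor R 0).
- apply: (@continuous_comp _ _ _ (coor 1) g); last exact: cg.
  exact: (@continuous_coor R 1).
- apply: (@continuous_comp _ _ _ (coor 2) h); last exact: ch.
  exact: (@continuous_coor R 2).
Qed.

Lemma Ck_tensor k (f g h : R -> R) :
  Ck1 k f -> Ck1 k g -> Ck1 k h -> Ck k (tensor f g h).
Proof.
elim: k f g h => [|k IH] f g h; first exact: continuous_tensor.
move=> fS gS hS; have := (Ck1S fS, Ck1S gS, Ck1S hS) => -[[fk gk] hk].
case: fS gS hS => df f' [dg g'] [dh h'] i.
have [->|->|->] := ord3P i.
- have E x : (fun t => tensor f g h (upd 0 x t)) = (g x.1.2 * h x.2) \*: f.
    by apply/funext => t; rewrite /tensor /upd/= /GRing.scale/= -mulrA mulrC.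
  split=> [x|]; first by apply/derivable_slice; rewrite E; exact: derivableZ.
  rewrite (_ : partial _ _ = tensor (derive1 f) g h); first exact: IH.
  apply/funext => x; rewrite partial_slice E derive1E deriveZ// -derive1E.
  by rewrite /tensor /GRing.scale/= mulrC mulrA.
- have E x : (fun t => tensor f g h (upd 1 x t)) = (f x.1.1 * h x.2) \*: g.
    by apply/funext => t; rewrite /tensor /upd/= /GRing.scale/=; ring.
  split=> [x|]; first by apply/derivable_slice; rewrite E; exact: derivableZ.
  rewrite (_ : partial _ _ = tensor f (derive1 g) h); first exact: IH.
  apply/funext => x; rewrite partial_slice E derive1E deriveZ// -derive1E.
  by rewrite /tensor /GRing.scale/=; ring.
- have E x : (fun t => tensor f g h (upd 2 x t)) = (f x.1.1 * g x.1.2) \*: h.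
    by apply/funext => t; rewrite /tensor /upd/= /GRing.scale/=; ring.
  split=> [x|]; first by apply/derivable_slice; rewrite E; exact: derivableZ.
  rewrite (_ : partial _ _ = tensor f g (derive1 h)); first exact: IH.
  by apply/funext => x; rewrite partial_slice E derive1E deriveZ// -derive1E.
Qed.

(** These functions of t tend to the indicator of ]a, b[ when n grows, because
    flat 1 (n s) tends to 1 for every s > 0. They are written with affine
    arguments, to which [Ck1_affine] applies; see [cutoffE]. *)
Definition cutoff (n : nat) (a b t : R) : R :=
  flat 1 (n.+1%:R * t + - (n.+1%:R * a)) * flat 1 ((- n.+1%:R) * t + n.+1%:R * b).

Lemma cutoffE n a b t :
  cutoff n a b t = flat 1 (n.+1%:R * (t - a)) * flat 1 (n.+1%:R * (b - t)).
Proof. by rewrite /cutoff; congr (flat 1 _ * flat 1 _); ring. Qed.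

Lemma cutoff_smooth k n a b : Ck1 k (cutoff n a b).
Proof. by apply: Ck1M; apply: Ck1_affine; exact: flat_smooth. Qed.

Lemma flat1_ge0 (t : R) : 0 <= flat 1 t.
Proof. by rewrite /flat; case: ifP => // _; rewrite hornerC mul1r expR_ge0. Qed.

Lemma flat1_le1 (t : R) : flat 1 t <= 1.
Proof.
rewrite /flat; case: ifP => // t0; rewrite hornerC mul1r -expR0 ler_expR.
by rewrite oppr_le0 invr_ge0 ltW.
Qed.

Lemma flat1_eq0 (t : R) : t <= 0 -> flat 1 t = 0.
Proof. by rewrite /flat => t0; rewrite ltNge t0. Qed.

Lemma cutoff_ge0 n a b t : 0 <= cutoff n a b t.
Proof. by rewrite mulr_ge0// flat1_ge0. Qed.

Lemma cutoff_le1 n a b t : cutoff n a b t <= 1.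
Proof. by rewrite mulr_ile1// ?flat1_ge0// flat1_le1. Qed.

Lemma cutoff_eq0 n a b t : t \notin `]a, b[ -> cutoff n a b t = 0.
Proof.
rewrite in_itv/= negb_and -!leNgt cutoffE => /orP[h|h].
  by rewrite flat1_eq0 ?mul0r// mulr_ge0_le0// subr_le0.
by rewrite [X in _ * X]flat1_eq0 ?mulr0// mulr_ge0_le0// subr_le0.
Qed.

Lemma flat1_cvg (s : R) : 0 < s -> flat 1 (n.+1%:R * s) @[n --> \oo] --> (1 : R).
Proof.
move=> s0.
rewrite (_ : (fun _ => _) = (fun n => expR (- (s^-1 * n.+1%:R^-1)))); last first.
  by apply/funext => n; rewrite /flat mulr_gt0// hornerC mul1r invfM mulrC.
suff : expR (- (s^-1 * n.+1%:R^-1)) @[n --> \oo] --> expR (- (s^-1 * 0)).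
  by rewrite mulr0 oppr0 expR0.
apply: continuous_cvg; first exact: continuous_expR.
by apply: cvgN; apply: cvgM; [exact: cvg_cst|exact: cvg_harmonic].
Qed.

Lemma cutoff_cvg a b t : cutoff n a b t @[n --> \oo] --> ((t \in `]a, b[)%:R : R).
Proof.
case: (boolP (t \in `]a, b[)) => tab; last first.
  rewrite (_ : (fun _ => _) = cst 0); first exact: cvg_cst.
  by apply/funext => n; rewrite cutoff_eq0.
move: tab; rewrite in_itv/= => /andP[at_ tb].
under eq_fun do rewrite cutoffE.
suff : flat 1 (n.+1%:R * (t - a)) * flat 1 (n.+1%:R * (b - t))
    @[n --> \oo] --> (1 * 1 : R).
  by rewrite mulr1.
by apply: cvgM; apply: flat1_cvg; rewrite subr_gt0.
Qed.

Definition bump (n : nat) (a b : R3 R) : R3 R -> R :=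
  tensor (cutoff n a.1.1 b.1.1) (cutoff n a.1.2 b.1.2) (cutoff n a.2 b.2).

Lemma bump_eq0 n a b x : ~ obox a b x -> bump n a b x = 0.
Proof.
move=> xab; rewrite /bump /tensor.
case: (boolP (x.1.1 \in `]a.1.1, b.1.1[)) => h1; last by rewrite cutoff_eq0 ?mul0r.
case: (boolP (x.1.2 \in `]a.1.2, b.1.2[)) => h2; last first.
  by rewrite [X in _ * X * _]cutoff_eq0 ?mulr0 ?mul0r.
case: (boolP (x.2 \in `]a.2, b.2[)) => h3; last first.
  by rewrite [X in _ * X]cutoff_eq0 ?mulr0.
by case: xab; exact: (conj (conj h1 h2) h3).
Qed.

Lemma bump_norm_le1 n a b x : `|bump n a b x| <= 1.
Proof.
have c0 := cutoff_ge0; have c1 := cutoff_le1.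
rewrite /bump /tensor ger0_norm; last first.
  by apply: mulr_ge0; [apply: mulr_ge0|]; exact: c0.
by apply: mulr_ile1; [apply: mulr_ge0|..|apply: mulr_ile1|];
  first [exact: c0|exact: c1].
Qed.

Lemma bump_cvg a b x : bump n a b x @[n --> \oo] --> (\1_(obox a b) x : R).
Proof.
rewrite indicE /bump /tensor.
rewrite (_ : (x \in obox a b)%:R = (x.1.1 \in `]a.1.1, b.1.1[)%:R *
  (x.1.2 \in `]a.1.2, b.1.2[)%:R * (x.2 \in `]a.2, b.2[)%:R :> R).
  by apply: cvgM; [apply: cvgM|]; exact: cutoff_cvg.
rewrite -!natrM !mulnb; congr (_%:R); congr nat_of_bool.
apply/idP/idP; first by rewrite inE => -[[/= -> ->] ->].
by move=> /andP[/andP[? ?] ?]; rewrite inE.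
Qed.

Lemma test_field_bump n a b (i : 'I_3) :
  test_field (fun x : R3 R => bump n a b x *: delta_mx 0 i).
Proof.
split.
  move=> j k.
  rewrite (_ : coord3 _ _ = tensor (fun t => (j == i)%:R * cutoff n a.1.1 b.1.1 t)
     (cutoff n a.1.2 b.1.2) (cutoff n a.2 b.2)); last first.
    by apply/funext => x; rewrite /coord3 !mxE/= /bump /tensor mulrC !mulrA.
  by apply: Ck_tensor; [apply: Ck1Z|..]; exact: cutoff_smooth.
pose K : set (R3 R) := (`[a.1.1, b.1.1] `*` `[a.1.2, b.1.2]) `*` `[a.2, b.2].
have cK : compact K.
  by apply: compact_setX; [apply: compact_setX|]; exact: segment_compact.
have clK : closed K by apply: compact_closed cK; exact: norm_hausdorff.
apply: (subclosed_compact _ cK); first exact: closed_closure.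
rewrite closureE => x; apply; split => // y /= y0.
have [[/= h1 h2] h3] : obox a b y.
  by apply: contrapT => yab; move: y0; rewrite bump_eq0// scale0r eqxx.
by split; [split|]; exact: subset_itv_oo_cc.
Qed.

End cutoffs.

(** * The Euclidean norm and Lebesgue spaces of fields *)

Section euclid.
Variable R : realType.
Implicit Types u v w : 'rV[R]_3.

Lemma dotE u v : dot u v = u 0 0 * v 0 0 + u 0 1 * v 0 1 + u 0 2 * v 0 2.
Proof.
rewrite /dot !big_ord_recl big_ord0 addr0 addrA.
by congr (_ * _ + _ * _ + _ * _); congr (_ _ _); apply/val_inj.
Qed.

Lemma dot_ge0 u : 0 <= dot u u.
Proof. by rewrite dotE !addr_ge0// -expr2 sqr_ge0. Qed.

Lemma enorm_ge0 u : 0 <= enorm u. Proof. exact: sqrtr_ge0. Qed.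

Lemma enorm_sq u : enorm u ^+ 2 = dot u u.
Proof. by rewrite sqr_sqrtr// dot_ge0. Qed.

Lemma dot_linearl u u' v c : dot (u + c *: u') v = dot u v + c * dot u' v.
Proof. by rewrite !dotE !mxE; ring. Qed.

Lemma coord_le_enorm u i : `|u 0 i| <= enorm u.
Proof.
rewrite -sqrtr_sqr ler_sqrt ?dot_ge0// dotE.
have := (sqr_ge0 (u 0 0), sqr_ge0 (u 0 1), sqr_ge0 (u 0 2)) => -[[h0 h1] h2].
have [->|->|->] := ord3P i; nra.
Qed.

Lemma enorm_eq0 u : enorm u = 0 -> u = 0.
Proof.
move=> u0; apply/rowP => i; rewrite mxE; apply/eqP.
by rewrite -normr_le0 -u0 coord_le_enorm.
Qed.

Lemma enorm0 : enorm (0 : 'rV[R]_3) = 0.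
Proof. by rewrite /enorm dotE !mxE !mul0r !addr0 sqrtr0. Qed.

Lemma enormZ (c : R) u : enorm (c *: u) = `|c| * enorm u.
Proof.
rewrite /enorm (_ : dot _ _ = c ^+ 2 * dot u u); last by rewrite !dotE !mxE; ring.
by rewrite sqrtrM ?sqr_ge0// sqrtr_sqr.
Qed.

(** By the parallelogram identity. This weak form of the triangle inequality is
    what [powRD_le] turns into stability of Lebesgue spaces under sums. *)
Lemma enormD_le u v : enorm (u + v) <= 2 * Num.max (enorm u) (enorm v).
Proof.
have m0 : 0 <= Num.max (enorm u) (enorm v) by rewrite le_max enorm_ge0.
rewrite -[leRHS]ger0_norm ?mulr_ge0// -sqrtr_sqr ler_sqrt ?sqr_ge0//.
have hu : dot u u <= Num.max (enorm u) (enorm v) ^+ 2.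
  by rewrite -enorm_sq lerXn2r ?nnegrE ?enorm_ge0// le_max lexx.
have hv : dot v v <= Num.max (enorm u) (enorm v) ^+ 2.
  by rewrite -enorm_sq lerXn2r ?nnegrE ?enorm_ge0// le_max lexx orbT.
have h : dot (u + v) (u + v) + dot (u - v) (u - v) = 2 * dot u u + 2 * dot v v.
  by rewrite !dotE !mxE; ring.
by have := dot_ge0 (u - v); nra.
Qed.

(** Lagrange's identity. *)
Lemma dot_cauchy_schwarz u v : `|dot u v| <= enorm u * enorm v.
Proof.
rewrite -sqrtr_sqr /enorm -sqrtrM ?dot_ge0// ler_sqrt ?mulr_ge0 ?dot_ge0//.
rewrite -subr_ge0 !dotE [X in 0 <= X](_ : _ =
  (u 0 0 * v 0 1 - u 0 1 * v 0 0) ^+ 2 + (u 0 0 * v 0 2 - u 0 2 * v 0 0) ^+ 2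
  + (u 0 1 * v 0 2 - u 0 2 * v 0 1) ^+ 2); last by ring.
by rewrite !addr_ge0// sqr_ge0.
Qed.

Lemma powRD_le (a b p : R) : 0 <= a -> 0 <= b -> 0 <= p ->
  (2 * Num.max a b) `^ p <= 2 `^ p * (a `^ p + b `^ p).
Proof.
move=> a0 b0 p0; rewrite powRM ?le_max ?a0//; apply: ler_wpM2l; first exact: powR_ge0.
by case: (leP a b) => _; rewrite ?lerDl ?lerDr powR_ge0.
Qed.

End euclid.

Section Lp_facts.
Variable R : realType.
Local Notation mR := (measurableTypeR R).
Local Notation T3 := (mR * mR * mR)%type.
Local Notation leb3 := (leb3 R).
Implicit Types (E F : vfield R) (f g : T3 -> R).

Definition mfield E := forall i, measurable_fun (setT : set T3) (coord3 E i).

Lemma mfield_dot E F : mfield E -> mfield F ->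
  measurable_fun (setT : set T3) (fun x => dot (E x) (F x)).
Proof.
move=> mE mF; rewrite (_ : (fun _ => _) = fun x => coord3 E 0 x * coord3 F 0 x +
  coord3 E 1 x * coord3 F 1 x + coord3 E 2 x * coord3 F 2 x).
  by do 2 (apply: measurable_funD; last exact: measurable_funM); exact: measurable_funM.
by apply/funext => x; rewrite dotE.
Qed.

Lemma mfield_enorm E : mfield E -> measurable_fun (setT : set T3) (@enorm R \o E).
Proof.
move=> mE; apply: (@measurableT_comp _ _ _ _ _ _ (@Num.sqrt R)).
  exact: continuous_measurable_fun (@sqrt_continuous R).
exact: mfield_dot.
Qed.

Lemma mfield_lin E F (c : R) : mfield E -> mfield F ->
  mfield (fun x => E x + c *: F x).
Proof.
move=> mE mF i; rewrite (_ : coord3 _ i = coord3 E i \+ (fun x => c * coord3 F i x)).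
  by apply: measurable_funD => //; apply: measurable_funM.
by apply/funext => x; rewrite /coord3 !mxE.
Qed.

Lemma dom_integrable f g : measurable_fun setT f -> (forall x, `|f x| <= g x) ->
  leb3.-integrable setT (EFin \o g) -> leb3.-integrable setT (EFin \o f).
Proof.
move=> mf fg; apply: le_integrable => //; first exact/measurable_EFinP.
by move=> x _ /=; rewrite lee_fin (le_trans (fg x))// ler_norm.
Qed.

Lemma integrable_add f g : leb3.-integrable setT (EFin \o f) ->
  leb3.-integrable setT (EFin \o g) ->
  leb3.-integrable setT (EFin \o (fun x => f x + g x)).
Proof.
move=> fi gi; have := integrableD measurableT fi gi.
by apply: eq_integrable.
Qed.

Lemma integrable_scale (c : R) f : leb3.-integrable setT (EFin \o f) ->
  leb3.-integrable setT (EFin \o (fun x => c * f x)).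
Proof.
move=> fi; have := integrableZl measurableT c fi.
by apply: eq_integrable.
Qed.

Lemma mfield_powR E (p : R) : mfield E ->
  measurable_fun (setT : set T3) (fun x => enorm (E x) `^ p).
Proof.
move=> mE; apply: (@measurableT_comp _ _ _ _ _ _ (@powR R ^~ p)).
  exact: measurable_powR.
exact: mfield_enorm.
Qed.

(** Finiteness of the norm, which is an extended real root of an integral,
    restated as integrability of a real function. *)
Lemma Lp3P E (p : R) : 0 < p ->
  Lp3 p E <-> mfield E /\ leb3.-integrable setT (EFin \o (fun x => enorm (E x) `^ p)).
Proof.
move=> p0.
have I0 : (0 <= \int[leb3]_x `|(enorm (E x) `^ p)%:E|)%E by exact: integral_ge0.
have EI : (\int[leb3]_x (`|(EFin \o (@enorm R \o E)) x| `^ p) =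
    \int[leb3]_x `|(enorm (E x) `^ p)%:E|)%E.
  apply: eq_integral => x _ /=.
  by rewrite ger0_norm ?enorm_ge0// ger0_norm// powR_ge0.
split=> -[mE h]; split => //.
  apply/integrableP; split; first by apply/measurable_EFinP; exact: mfield_powR.
  rewrite -EI -poweR_Lnorm ?gt_eqF//.
  by apply: poweR_lty; exact: h.
rewrite /finite_norm unlock /Lnorm poweR_lty// EI.
by move/integrableP : h => [_].
Qed.

Lemma powR2 (a : R) : 0 <= a -> a `^ 2 = a ^+ 2.
Proof. by move=> a0; rewrite powR_mulrn. Qed.

Lemma L2P E : Lp3 2 E <->
  mfield E /\ leb3.-integrable setT (EFin \o (fun x => enorm (E x) ^+ 2)).
Proof.
rewrite Lp3P//.
by under [X in EFin \o X]eq_fun do rewrite powR2 ?enorm_ge0//.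
Qed.

Lemma Lp3_zero (p : R) : 0 < p -> Lp3 p (fun=> 0 : 'rV[R]_3).
Proof.
move=> p0; apply/Lp3P => //; split.
  move=> i; rewrite (_ : coord3 _ _ = cst 0); first exact: measurable_cst.
  by apply/funext => x; rewrite /coord3 mxE.
rewrite (_ : EFin \o _ = cst 0%E); first exact: integrable0.
by apply/funext => x; rewrite /= enorm0 powR0// gt_eqF.
Qed.

Lemma Lp3_lin E F (p c : R) : 0 < p -> Lp3 p E -> Lp3 p F ->
  Lp3 p (fun x => E x + c *: F x).
Proof.
move=> p0 /(Lp3P _ p0)[mE iE] /(Lp3P _ p0)[mF iF]; apply/Lp3P => //.
have mS := mfield_lin c mE mF; split => //.
apply: (@dom_integrable _
  (fun x => 2 `^ p * (enorm (E x) `^ p + `|c| `^ p * enorm (F x) `^ p))).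
- exact: mfield_powR.
- move=> x; rewrite ger0_norm ?powR_ge0// -powRM ?enorm_ge0// -enormZ.
  apply: le_trans (powRD_le _ _ _); rewrite ?enorm_ge0 ?(ltW p0)//.
  apply: ge0_ler_powR; rewrite ?nnegrE ?enorm_ge0 ?(ltW p0)//.
    by rewrite mulr_ge0// le_max enorm_ge0.
  exact: enormD_le.
- by apply: integrable_scale; apply: integrable_add => //; exact: integrable_scale.
Qed.

End Lp_facts.

(** * Test fields separate square integrable fields *)

Section test_functions.
Variable R : realType.
Local Notation mR := (measurableTypeR R).
Local Notation T3 := (mR * mR * mR)%type.
Local Notation leb3 := (leb3 R).
Implicit Types (E F : vfield R) (f g : R3 R -> R).

Definition compactly_supported f := exists2 K : set (R3 R),
  compact K & forall x, ~ K x -> f x = 0.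

Lemma continuous_compact_bound f (K : set (R3 R)) : continuous f -> compact K ->
  exists M : R, forall x, K x -> `|f x| <= M.
Proof.
move=> cf cK.
have /compact_bounded[M [_ HM]] : compact (f @` K).
  by apply: continuous_compact => //; exact: continuous_subspaceT.
by exists (M + 1) => x Kx; apply: HM; [rewrite ltrDl|exists x].
Qed.

Lemma compactly_supported_bounded f : continuous f -> compactly_supported f ->
  exists M k : R, (forall x, `|f x| <= M) /\ (forall x, ~ cube k x -> f x = 0).
Proof.
move=> cf [K cK fK].
have [M HM] := continuous_compact_bound cf cK.
have c1 : continuous (fun x : R3 R => x.1.1) := @continuous_coor R 0.
have c2 : continuous (fun x : R3 R => x.1.2) := @continuous_coor R 1.
have c3 : continuous (fun x : R3 R => x.2) := @continuous_coor R 2.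
have [k1 H1] := continuous_compact_bound c1 cK.
have [k2 H2] := continuous_compact_bound c2 cK.
have [k3 H3] := continuous_compact_bound c3 cK.
exists (Num.max 0 M), (Num.max k1 (Num.max k2 k3)); split=> x.
  have [Kx|/fK ->] := pselect (K x); last by rewrite normr0 le_max lexx.
  by rewrite le_max HM ?orbT.
move=> xk; apply: fK => Kx; apply: xk.
by split; [split|]; rewrite /= in_itv/= -ler_norml !le_max
  ?(H1 x) ?(H2 x) ?(H3 x) ?orbT.
Qed.

Lemma integrable_bounded_support f : continuous f -> compactly_supported f ->
  leb3.-integrable setT (EFin \o f).
Proof.
move=> cf sf; have [M [k [fM fk]]] := compactly_supported_bounded cf sf.
by apply: (@bounded_cube_integrable _ _ M k) => //; exact: continuous_measurable3.
Qed.

Lemma compactly_supported_partial f i : compactly_supported f ->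
  compactly_supported (partial i f).
Proof.
move=> [K cK fK]; exists K => // x nKx.
have clK : closed K by apply: compact_closed cK; exact: norm_hausdorff.
rewrite /partial (@near_eq_derive _ _ _ f (cst 0)); first exact: derive_cst.
have : nbhs x (~` K) by apply: open_nbhs_nbhs; split => //; exact: closed_openC.
by apply: filterS => y /fK.
Qed.

(** By the inequality of arithmetic and geometric means, pointwise. *)
Lemma integrable_L2_mul E i f : Lp3 2 E -> continuous f -> compactly_supported f ->
  leb3.-integrable setT (EFin \o (fun x => coord3 E i x * f x)).
Proof.
move=> /L2P[mE iE] cf [K cK fK].
apply: (@dom_integrable _ _ (fun x => enorm (E x) ^+ 2 + f x ^+ 2)).
- by apply: measurable_funM => //; exact: continuous_measurable3.
- move=> x; rewrite normrM.
  have h1 := coord_le_enorm (E x) i; have h0 := normr_ge0 (f x).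
  rewrite -(real_normK (num_real (f x))) /coord3.
  have := sqr_ge0 (`|E x 0 i| - `|f x|).
  have := normr_ge0 (E x 0 i); nra.
- apply: integrable_add => //; apply: integrable_bounded_support.
    move=> x; apply: (@continuous_comp _ _ _ f (fun y => y ^+ 2)).
      exact: cf.
    exact: exprn_continuous.
  by exists K => // x /fK ->; rewrite expr0n.
Qed.

(** The property shared by a test field and its curl that makes the pairings
    with square integrable fields converge. *)
Definition tame (phi : vfield R) := forall i,
  continuous (coord3 phi i) /\ compactly_supported (coord3 phi i).

Lemma tame_test phi : test_field phi -> tame phi.
Proof.
move=> [sphi cphi] i; split; first exact: (sphi i 0).
exists (closure [set x | phi x != 0]) => // x nx.
have -> : coord3 phi i x = phi x 0 i by [].
suff -> : phi x = 0 by rewrite mxE.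
by apply: contrapT => /eqP px; apply: nx; exact: subset_closure.
Qed.

Lemma tame_curl phi : test_field phi -> tame (curl phi).
Proof.
move=> tphi; have tm := tame_test tphi; have [sphi _] := tphi.
have cp i j : continuous (partial i (coord3 phi j)) by have [_] := sphi j 1 i.
move=> i.
have -> : coord3 (curl phi) i = fun x => partial (i + 1) (coord3 phi (i + 2)) x -
                partial (i + 2) (coord3 phi (i + 1)) x.
  by apply/funext => x; rewrite /coord3 mxE.
split; first by move=> x; apply: cvgB; exact: cp.
have [_ /(compactly_supported_partial (i + 1))[K1 cK1 K10]] := tm (i + 2).
have [_ /(compactly_supported_partial (i + 2))[K2 cK2 K20]] := tm (i + 1).
exists (K1 `|` K2); first exact: compactU.
by move=> x /not_orP[/K10 -> /K20 ->]; rewrite subrr.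
Qed.

Lemma integrable_dot E phi : Lp3 2 E -> tame phi ->
  leb3.-integrable setT (EFin \o (fun x => dot (E x) (phi x))).
Proof.
move=> E2 tphi.
rewrite (_ : (fun _ => _) = fun x => coord3 E 0 x * coord3 phi 0 x +
  coord3 E 1 x * coord3 phi 1 x + coord3 E 2 x * coord3 phi 2 x); last first.
  by apply/funext => x; rewrite dotE.
have I i : leb3.-integrable setT (EFin \o (fun x => coord3 E i x * coord3 phi i x)).
  by have [cf sf] := tphi i; exact: integrable_L2_mul.
by apply: integrable_add => //; exact: integrable_add.
Qed.

Lemma Rintegral_dot_lin E F phi (c : R) : Lp3 2 E -> Lp3 2 F -> tame phi ->
  \int[leb3]_x dot (E x + c *: F x) (phi x) =
  \int[leb3]_x dot (E x) (phi x) + c * \int[leb3]_x dot (F x) (phi x).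
Proof.
move=> E2 F2 tphi.
rewrite -RintegralZl//; last exact: integrable_dot.
rewrite -RintegralD//; [|exact: integrable_dot|]; last first.
  by apply: integrable_scale; exact: integrable_dot.
by apply: eq_Rintegral => x _; rewrite dot_linearl.
Qed.

Lemma is_weak_curl_lin E E' F F' (c : R) : Lp3 2 E -> Lp3 2 E' -> Lp3 2 F -> Lp3 2 F' ->
  is_weak_curl E F -> is_weak_curl E' F' ->
  is_weak_curl (fun x => E x + c *: E' x) (fun x => F x + c *: F' x).
Proof.
move=> E2 E'2 F2 F'2 cE cE' phi tphi.
have t1 := tame_test tphi; have t2 := tame_curl tphi.
by rewrite !Rintegral_dot_lin// cE// cE'.
Qed.

(** The bumps are bounded by 1 and converge to the indicator of their box, so
    by dominated convergence f has zero integral over every box; hence over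
    every measurable set, which forces f to vanish almost everywhere. *)
Lemma test_functions_separate (f : T3 -> R) :
  measurable_fun setT f ->
  (forall k, leb3.-integrable setT
    (EFin \o (fun x => f x * \1_(obox (-k, -k, -k) (k, k, k)) x))) ->
  (forall n a b, \int[leb3]_x (f x * bump n a b x) = 0) ->
  {ae leb3, forall x, f x = 0}.
Proof.
move=> mf fi f0.
suff H (k : nat) : {ae leb3, forall x,
    f x * \1_(obox (-k%:R, -k%:R, -k%:R) (k%:R, k%:R, k%:R)) x = 0}.
  apply: filterS (ae_foralln H) => x Hx.
  pose k := Num.bound (Num.max `|x.1.1| (Num.max `|x.1.2| `|x.2|)).
  have := @archi_boundP _ (Num.max `|x.1.1| (Num.max `|x.1.2| `|x.2|)).
  rewrite le_max normr_ge0 => /(_ isT); rewrite -/k !gt_max => /andP[h1 /andP[h2 h3]].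
  have := Hx k; rewrite indicE mem_set ?mulr1//.
  by split; [split|]; rewrite /= in_itv/= -ltr_norml.
pose Q := obox (-k%:R, -k%:R, -k%:R) (k%:R, k%:R, k%:R : R).
pose g x := (f x * \1_Q x)%:E.
have gi : leb3.-integrable setT g := fi k%:R.
have gabs : leb3.-integrable setT (abse \o g) by exact: integrable_abse.
have box0 a b : (\int[leb3]_(x in obox a b) g x = 0)%E.
  set a' : R3 R := (Num.max a.1.1 (-k%:R), Num.max a.1.2 (-k%:R), Num.max a.2 (-k%:R)).
  set b' : R3 R := (Num.min b.1.1 k%:R, Num.min b.1.2 k%:R, Num.min b.2 k%:R).
  have E : obox a b `&` Q = obox a' b' by rewrite /Q oboxI.
  have sub : obox a' b' `<=` Q by rewrite -E; exact: subIsetr.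
  pose u n x := (f x * bump n a' b' x)%:E.
  have ule n x : (`|u n x| <= (abse \o g) x)%E.
    rewrite /u /g /= lee_fin normrM [leRHS]normrM ler_wpM2l//.
    have [xQ|xQ] := pselect (obox a' b' x).
      have -> : \1_Q x = 1 :> R by rewrite indicE mem_set//; exact: sub.
      by rewrite normr1; exact: bump_norm_le1.
    by rewrite bump_eq0// normr0.
  have mu_ n : measurable_fun setT (u n).
    apply/measurable_EFinP; apply: measurable_funM => //.
    apply: continuous_measurable3; apply: continuous_tensor;
      exact: Ck1_continuous (cutoff_smooth 0 _ _ _).
  have u0 n : (\int[leb3]_x u n x = 0)%E.
    have ui : leb3.-integrable setT (u n).
      apply: le_integrable gabs => //.
      by move=> x _; apply: le_trans (ule n x) _; rewrite /= normr_id.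
    have := f0 n a' b'; rewrite /Rintegral => h.
    by rewrite -[LHS]fineK ?h//; exact: integrable_fin_num.
  rewrite integral_mkcond (_ : _ \_ _ =
    (fun x => (f x * \1_(obox a' b') x)%:E)); last first.
    apply/funext => x; rewrite patchE /g -E indicI /=.
    by rewrite [\1_(obox a b) x]indicE; case: ifPn => xab; rewrite ?mul1r// mul0r mulr0.
  have mlim : measurable_fun setT (fun x => (f x * \1_(obox a' b') x)%:E).
    apply/measurable_EFinP; apply: measurable_funM => //.
    by apply: measurable_indic; exact: measurable_obox.
  have ulim x : u n x @[n --> \oo] --> (f x * \1_(obox a' b') x)%:E.
    apply: cvg_EFin; first exact: nearW.
    by apply: cvgM; [exact: cvg_cst|exact: bump_cvg].
  have [_ _ uc] := @dominated_convergence _ _ _ leb3 setT measurableT u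
    (fun x => (f x * \1_(obox a' b') x)%:E) (abse \o g) mu_ mlim
    (aeW _ (fun x _ => ulim x))
    gabs (aeW _ (fun x n _ => ule n x)).
  have u0' : (fun n => \int[leb3]_x u n x)%E = cst 0%E by apply/funext => n; exact: u0.
  rewrite u0' in uc.
  exact: (cvg_unique _ uc (cvg_cst _)).
have gQ x : ~ Q x -> g x = 0%E.
  by move=> Qx; rewrite /g indicE memNset// mulr0.
have all0 := integral_oboxes_eq0 gi gQ box0.
have ae0 : ae_eq leb3 setT g (cst 0%E).
  by apply: integral_ae_eq => // A _ mA; rewrite all0// integral0.
by apply: filterS ae0 => x /(_ Logic.I)[].
Qed.

End test_functions.

(** * Uniqueness and linearity of the weak curl *)

Section weak_curl_unique.
Variable R : realType.
Local Notation mR := (measurableTypeR R).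
Local Notation T3 := (mR * mR * mR)%type.
Local Notation leb3 := (leb3 R).
Implicit Types (E F : vfield R).

Lemma ae_leb3S (P Q : R3 R -> Prop) : (forall x, P x -> Q x) ->
  {ae leb3, forall x, P x} -> {ae leb3, forall x, Q x}.
Proof. by move=> PQ; exact: (@filterS _ (almost_everywhere leb3) _ P Q PQ). Qed.

Lemma L2_eq0_of_test F : Lp3 2 F ->
  (forall phi, test_field phi -> \int[leb3]_x dot (F x) (phi x) = 0) ->
  {ae leb3, forall x, F x = 0}.
Proof.
move=> F2 F0; have /L2P[mF iF] := F2.
have H i : {ae leb3, forall x, coord3 F i x = 0}.
  apply: test_functions_separate => //.
    move=> k; set Q := obox _ _.
    have mQ : measurable Q := measurable_obox _ _.
    have cubeQ x : ~ cube k x -> \1_Q x = 0 :> R.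
      move=> xk; rewrite indicE memNset// => -[[/= h1 h2] h3]; apply: xk.
      by split; [split|]; exact: subset_itv_oo_cc.
    have iQ : leb3.-integrable setT (EFin \o (\1_Q : T3 -> R)).
      apply: (@bounded_cube_integrable _ _ 1 k) => //.
      by move=> x; rewrite indicE; case: (_ \in _); rewrite ?normr1 ?normr0.
    apply: (@dom_integrable _ _ (fun x => enorm (F x) ^+ 2 + \1_Q x)).
    + by apply: measurable_funM => //; apply: measurable_indic.
    + move=> x; rewrite indicE; case: (x \in Q);
        rewrite ?mulr0 ?normr0 ?addr0 ?sqr_ge0//.
      rewrite mulr1; have h := coord_le_enorm (F x) i; rewrite /coord3.
      rewrite mulr1n; have := sqr_ge0 (enorm (F x) - 1); have := enorm_ge0 (F x); nra.
    + exact: integrable_add.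
  move=> n a b; rewrite -(F0 _ (test_field_bump n a b i)).
  apply: eq_Rintegral => x _; rewrite dotE !mxE /coord3.
  by have [->|->|->] := ord3P i; rewrite /=; ring.
apply: filterS (ae_foralln (fun n => H (inord n))) => x Hx.
by apply/rowP => i; rewrite mxE -(inord_val i) -(Hx i).
Qed.

Lemma weak_curl_unique E F F' : Lp3 2 F -> Lp3 2 F' ->
  is_weak_curl E F -> is_weak_curl E F' -> {ae leb3, forall x, F x = F' x}.
Proof.
move=> F2 F'2 cF cF'.
have D2 := Lp3_lin (-1) (ltr0Sn R 1) F2 F'2.
have D0 : {ae leb3, forall x, F x + (-1) *: F' x = 0}.
  apply: L2_eq0_of_test => // phi tphi.
  rewrite Rintegral_dot_lin//; last exact: tame_test.
  by rewrite cF// cF'// mulN1r subrr.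
by apply: ae_leb3S D0 => x /eqP; rewrite scaleN1r subr_eq0 => /eqP.
Qed.

Lemma wcurlP E : Hcurl E -> Lp3 2 (wcurl E) /\ is_weak_curl E (wcurl E).
Proof.
move=> [_ [F HF]]; rewrite /wcurl.
exact: (@xgetPex _ 0 [set F | Lp3 2 F /\ is_weak_curl E F] (ex_intro _ F HF)).
Qed.

(** [wcurl E] is an arbitrary choice among the weak curls of E; this lemma makes
    it computable, up to a null set, from any explicit one. *)
Lemma wcurl_ae E F : Lp3 2 F -> is_weak_curl E F -> Lp3 2 E ->
  {ae leb3, forall x, wcurl E x = F x}.
Proof.
move=> F2 cF E2.
have [w2 cw] : Lp3 2 (wcurl E) /\ is_weak_curl E (wcurl E).
  by apply: wcurlP; split => //; exists F.
exact: weak_curl_unique cw cF.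
Qed.

Lemma ae_eq_Rintegral (f g : T3 -> R) :
  measurable_fun setT f -> measurable_fun setT g ->
  {ae leb3, forall x, f x = g x} -> \int[leb3]_x f x = \int[leb3]_x g x.
Proof.
move=> mf mg fg; congr fine; apply: ae_eq_integral => //; try exact/measurable_EFinP.
by apply: ae_leb3S fg => x -> _.
Qed.

Lemma Hcurl_lin E E' (c : R) : Hcurl E -> Hcurl E' -> Hcurl (fun x => E x + c *: E' x).
Proof.
move=> [E2 [F [F2 cF]]] [E'2 [F' [F'2 cF']]]; split; first exact: Lp3_lin.
exists (fun x => F x + c *: F' x); split; first exact: Lp3_lin.
exact: is_weak_curl_lin.
Qed.

End weak_curl_unique.

(** * Expansion of the nonlinearity at vectors of norm 0 or 1 *)

Section nonlinearity.
Variable R : realType.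

(** x `^ r lies between 1 and x ^+ m, and x ^+ m - 1 is x - 1 times a geometric
    sum. Unlike a bound on the derivative of x `^ r, this also covers r < 1, for
    which the derivative is unbounded near 0. *)
Lemma powR_sub1_le (r x : R) (m : nat) : 0 <= r <= m%:R -> 0 < x <= 4 ->
  `|x `^ r - 1| <= m%:R * 4 ^+ m * `|x - 1|.
Proof.
move=> /andP[r0 rm] /andP[x0 x4].
have S : \sum_(i < m) x ^+ i <= m%:R * 4 ^+ m.
  apply: (@le_trans _ _ (\sum_(i < m) 4 ^+ m)); last first.
    by rewrite sumr_const card_ord mulr_natl.
  apply: ler_sum => i _; apply: (@le_trans _ _ (4 ^+ i)).
    by rewrite lerXn2r// nnegrE// ltW.
  by rewrite ler_weXn2l ?ler1n// ltnW.
have xm : x ^+ m - 1 = (x - 1) * \sum_(i < m) x ^+ i by rewrite subrX1.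
have S0 : 0 <= \sum_(i < m) x ^+ i by apply: sumr_ge0 => i _; rewrite exprn_ge0// ltW.
apply: (@le_trans _ _ `|x ^+ m - 1|); last first.
  by rewrite xm normrM mulrC ler_wpM2r// ger0_norm.
rewrite -(powR_mulrn _ (ltW x0)).
have [x1|x1] := leP x 1.
  have h1 : x `^ r <= 1 by rewrite -(powRr0 x) ger_powR ?x0.
  have h2 : x `^ m%:R <= x `^ r by rewrite ger_powR ?x0.
  by rewrite !ler0_norm; lra.
have h1 : 1 <= x `^ r by rewrite -[leLHS](powRr0 x) ler_powR// ltW.
have h2 : x `^ r <= x `^ m%:R by rewrite ler_powR// ltW.
by rewrite !ger0_norm; lra.
Qed.

(** The mean value theorem turns the error into
    q * (xi `^ (q - 1) - 1) * (s - 1) with xi between s and 1. The second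
    derivative of s `^ q is of no help when q < 2, as it blows up at 0. The
    bound 4 is the value of |e + h| ^+ 2 for parallel unit vectors e and h. *)
Lemma powR_tangent_error (q : R) : 1 < q -> exists2 C : R, 0 <= C &
  forall s : R, 0 <= s <= 4 -> `|s `^ q - 1 - q * (s - 1)| <= C * (s - 1) ^+ 2.
Proof.
move=> q1; have q0 : 0 < q by lra.
pose m := Num.bound (q - 1).
have rm : 0 <= q - 1 <= m%:R.
  by apply/andP; split; [lra|apply/ltW/archi_boundP; lra].
pose K : R := m%:R * 4 ^+ m.
have K0 : 0 <= K by rewrite mulr_ge0// exprn_ge0.
exists (q * (K + 1)); first by rewrite mulr_ge0; lra.
move=> s /andP[]; rewrite le_eqVlt => /predU1P[<- _|s0 s4].
  by rewrite powR0 ?gt_eqF// sub0r mulrN1 opprK expr2 ler_norml; apply/andP; split; nra.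
have [xi [x0 [x4 [xs E]]]] : exists xi, 0 < xi /\ xi <= 4 /\ `|xi - 1| <= `|s - 1| /\
    s `^ q - 1 = q * xi `^ (q - 1) * (s - 1).
  have D (x : R) : 0 < x -> is_derive x 1 (@powR R ^~ q) (q * x `^ (q - 1)).
    by move=> x0; exact: is_derive1_powR.
  have [s1|s1] := leP s 1.
    have [||xi] := @MVT_segment _ (@powR R ^~ q) (fun x => q * x `^ (q - 1)) s 1 s1.
    + by move=> x /[!in_itv]/= /andP[sx _]; apply: D; lra.
    + apply: derivable_within_continuous => x /[!in_itv]/= /andP[sx _].
      have x0 : 0 < x by lra.
      by have [] := D x x0.
    rewrite in_itv/= => /andP[h1 h2]; rewrite powR1 => E.
    exists xi; split; [lra|split; [lra|split; first by rewrite !ler0_norm; lra]].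
    by rewrite -opprB E; ring.
  have [||xi] := @MVT_segment _ (@powR R ^~ q) (fun x => q * x `^ (q - 1)) 1 s (ltW s1).
  + by move=> x /[!in_itv]/= /andP[sx _]; apply: D; lra.
  + apply: derivable_within_continuous => x /[!in_itv]/= /andP[sx _].
    have x0 : 0 < x by lra.
    by have [] := D x x0.
  rewrite in_itv/= => /andP[h1 h2]; rewrite powR1 => E.
  exists xi; split; [lra|split; [lra|split => //]].
  by rewrite !ger0_norm; lra.
rewrite E (_ : _ - _ = q * ((xi `^ (q - 1) - 1) * (s - 1))); last by ring.
rewrite normrM (gtr0_norm q0) -mulrA ler_wpM2l ?(ltW q0)// normrM.
have x04 : 0 < xi <= 4 by rewrite x0.
have h := powR_sub1_le rm x04.
rewrite -(real_normK (num_real (s - 1))).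
have := normr_ge0 (s - 1); have := normr_ge0 (xi - 1).
have := normr_ge0 (xi `^ (q - 1) - 1).
rewrite -/K in h => a0 b0 c0.
have h' : `|xi `^ (q - 1) - 1| <= K * `|s - 1|.
  by apply: le_trans h _; rewrite ler_wpM2l.
nra.
Qed.

(** The linear term of the expansion of |e + h| ^ (2 q) is 2 q |e| ^ (2 q - 2) e.h,
    which is 2 q e.h exactly because |e| is 0 or 1. For |h| <= 1 the remainder is
    controlled by the tangent error of s `^ q at s = |e + h| ^+ 2, for |h| >= 1
    by the size of each term. *)
Lemma power_remainder (q : R) : 1 < q -> exists2 C : R, 0 <= C &
  forall e h : 'rV[R]_3, e = 0 \/ enorm e = 1 ->
  `|enorm (e + h) `^ (2 * q) - enorm e `^ (2 * q) - 2 * q * dot e h| <=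
    C * (enorm h ^+ 2 + enorm h `^ (2 * q)).
Proof.
move=> q1; have q0 : 0 < q by lra.
have [C C0 HC] := powR_tangent_error q1.
exists (1 + 9 * C + 4 `^ q + 1 + 2 * q).
  by have := powR_ge0 4 q; lra.
move=> e h he.
have p4 := powR_ge0 4 q.
have ph := powR_ge0 (enorm h) (2 * q).
have h0 := enorm_ge0 h.
have hh := sqr_ge0 (enorm h).
case: he => [->|e1].
  rewrite add0r enorm0 powR0 ?gt_eqF ?mulr_gt0// (_ : dot 0 h = 0); last first.
    by rewrite dotE !mxE; ring.
  rewrite mulr0 !subr0 ger0_norm//; nra.
have pE (u : 'rV[R]_3) : enorm u `^ (2 * q) = (enorm u ^+ 2) `^ q.
  by rewrite powRrM powR_mulrn// enorm_ge0.
rewrite e1 powR1 pE.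
set s := enorm (e + h) ^+ 2.
have s0 : 0 <= s by exact: sqr_ge0.
have sE : s = 1 + 2 * dot e h + enorm h ^+ 2.
  have : enorm e ^+ 2 = 1 by rewrite e1 expr1n.
  by rewrite /s !enorm_sq !dotE !mxE; nra.
have /ler_normlP[cs1 cs2] := dot_cauchy_schwarz e h.
rewrite e1 mul1r in cs1 cs2.
(* Here s <= 4 and |s - 1| <= 3 |h|, whence the factor 9. *)
have [h1|h1] := leP (enorm h) 1.
  have s4 : 0 <= s <= 4 by rewrite s0/= sE; nra.
  have := HC s s4.
  have sq : (s - 1) ^+ 2 <= 9 * enorm h ^+ 2.
    rewrite (_ : 9 * _ = (3 * enorm h) ^+ 2); last by ring.
    rewrite -ler_sqrt ?sqr_ge0// !sqrtr_sqr [leRHS]ger0_norm; last lra.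
    by rewrite sE ler_norml; apply/andP; split; nra.
  have : C * (s - 1) ^+ 2 <= C * (9 * enorm h ^+ 2) by rewrite ler_wpM2l.
  move=> k1 /ler_normlP[k2 k3].
  rewrite ler_norml; apply/andP; split; nra.
have s4 : s <= 4 * enorm h ^+ 2 by rewrite sE; nra.
have sq : s `^ q <= 4 `^ q * enorm h `^ (2 * q).
  by rewrite pE -powRM// ge0_ler_powR ?nnegrE ?(ltW q0)// mulr_ge0.
have sq0 := powR_ge0 s q.
have n1 : enorm h <= enorm h ^+ 2 by nra.
have d1 : q * dot e h <= q * enorm h ^+ 2 by rewrite ler_wpM2l ?(ltW q0)//; lra.
have d2 : q * - dot e h <= q * enorm h ^+ 2 by rewrite ler_wpM2l ?(ltW q0)//; lra.
have Cn := mulr_ge0 C0 hh; have Cp := mulr_ge0 C0 ph.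
have qp := mulr_ge0 (ltW q0) ph; have pn := mulr_ge0 p4 hh.
rewrite ler_norml; apply/andP; split; nra.
Qed.

End nonlinearity.

(** * A curl-free field of norm 0 or 1 *)

Section octahedron.
Variable R : realType.
Local Notation mR := (measurableTypeR R).
Local Notation T3 := (mR * mR * mR)%type.
Local Notation leb3 := (leb3 R).
Implicit Types (x : R3 R) (g : R3 R -> R).

Definition norm1 x : R := `|x.1.1| + `|x.1.2| + `|x.2|.

(** On the line through x of direction i, the octahedron norm1 < r is the
    interval ]-a, a[ with a = [radius r i x], or empty if a <= 0. *)
Definition radius (r : R) i x : R := r - (norm1 x - `|coor i x|).

(** The field -grad ([pyramid r]). Its coordinates are 1 / sqrt 3 or -1 / sqrt 3
    inside the octahedron norm1 < r, and 0 outside. *)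
Definition octa (r : R) : vfield R := fun x =>
  \row_i ((Num.sqrt 3)^-1 * dtent (radius r i x) (coor i x)).

(** A Lipschitz function whose gradient has norm 1 on its support: each of the
    three partial derivatives of norm1 is 1 or -1. *)
Definition pyramid (r : R) x : R := (Num.sqrt 3)^-1 * Num.max 0 (r - norm1 x).

Lemma norm1_upd i x t : norm1 (upd i x t) = norm1 x - `|coor i x| + `|t|.
Proof.
by case: x => -[x y] z; have [->|->|->] := ord3P i; rewrite /norm1 /upd /coor /=; ring.
Qed.

Lemma radius_upd r i x t : radius r i (upd i x t) = radius r i x.
Proof. by rewrite /radius coor_upd norm1_upd; ring. Qed.

Lemma coor_lt_radius r i x : (`|coor i x| < radius r i x) = (norm1 x < r).
Proof. by rewrite /radius; apply/idP/idP; lra. Qed.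

Lemma pyramid_tent r i x :
  pyramid r x = (Num.sqrt 3)^-1 * tent (radius r i x) (coor i x).
Proof. by rewrite /pyramid /tent /radius; congr (_ * Num.max 0 _); ring. Qed.

Lemma octaE r i x : coord3 (octa r) i x =
  if norm1 x < r then (Num.sqrt 3)^-1 * (if coor i x <= 0 then 1 else -1) else 0.
Proof.
by rewrite /coord3 mxE /dtent coor_lt_radius; case: ifP => // _; rewrite mulr0.
Qed.

Lemma enorm_octa r x : enorm (octa r x) = (norm1 x < r)%R%:R.
Proof.
have E i : octa r x 0 i = coord3 (octa r) i x by [].
rewrite /enorm dotE !E !octaE; case: ifP => _; last by rewrite !mulr0 !addr0 sqrtr0.
have s3 : (Num.sqrt 3)^-1 * (Num.sqrt 3)^-1 = 3^-1 :> R.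
  by rewrite -invfM -expr2 sqr_sqrtr.
rewrite [X in Num.sqrt X](_ : _ = 1) ?sqrtr1//.
have H (b : bool) : (Num.sqrt 3)^-1 * (if b then 1 else -1) *
    ((Num.sqrt 3)^-1 * (if b then 1 else -1)) = 3^-1 :> R.
  by rewrite -s3; case: b; ring.
by rewrite !H; lra.
Qed.

Lemma continuous_norm1 : continuous norm1.
Proof.
rewrite (_ : norm1 = fun x => `|coor 0 x| + `|coor 1 x| + `|coor 2 x|)//.
by move=> x;
  do 2 (apply: cvgD; last by apply: cvg_norm; exact: continuous_coor);
  apply: cvg_norm; exact: continuous_coor.
Qed.

Lemma mfield_octa r : mfield (octa r).
Proof.
move=> i; rewrite (_ : coord3 _ _ = fun x =>
  if norm1 x < r then (Num.sqrt 3)^-1 * (if coor i x <= 0 then 1 else -1) else 0);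
  last by apply/funext => x; rewrite octaE.
apply: measurable_fun_ifT => //.
  apply: measurable_fun_ltr => //; exact: (continuous_measurable3 continuous_norm1).
apply: measurable_funM => //; apply: measurable_fun_ifT => //.
by apply: measurable_fun_ler => //; exact: (continuous_measurable3 (@continuous_coor R i)).
Qed.

Lemma norm1_cube r x : norm1 x < r -> cube r x.
Proof.
rewrite /norm1 => h; have h1 := normr_ge0 x.1.1.
have h2 := normr_ge0 x.1.2; have h3 := normr_ge0 x.2.
by split; [split|]; rewrite /= in_itv/= -ler_norml; lra.
Qed.

Lemma compact_cube (k : R) : compact (cube k : set (R3 R)).
Proof. by apply: compact_setX; [apply: compact_setX|]; exact: segment_compact. Qed.

Lemma integrable_mul_continuous (r M : R) (w : T3 -> R) g :
  measurable_fun setT w -> (forall x, `|w x| <= M) ->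
  (forall x, ~ norm1 x < r -> w x = 0) -> continuous g ->
  leb3.-integrable setT (EFin \o (fun x => w x * g x)).
Proof.
move=> mw wM w0 cg.
have [B HB] := continuous_compact_bound cg (@compact_cube r).
apply: (@bounded_cube_integrable _ _ (M * Num.max 0 B) r).
- by apply: measurable_funM => //; exact: continuous_measurable3.
- by move=> x xr; rewrite w0 ?mul0r// => h; apply: xr; exact: norm1_cube.
- move=> x; have [xr|xr] := pselect (norm1 x < r); last first.
    by rewrite w0// mul0r normr0 mulr_ge0 ?le_max ?lexx// (le_trans _ (wM x)).
  rewrite normrM ler_pM// le_max HB ?orbT//.
  exact: norm1_cube.
Qed.

Lemma octa_le1 r i x : `|coord3 (octa r) i x| <= 1.
Proof.
apply: (le_trans (coord_le_enorm _ _)); rewrite enorm_octa.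
by case: (_ < _).
Qed.

(** On each line of direction i the pyramid is a tent. *)
Lemma octa_by_parts r i g : (forall x, derivable g x (basis3 R i)) ->
  continuous g -> continuous (partial i g) ->
  leb3.-integrable setT (EFin \o
    (fun x => coord3 (octa r) i x * g x + pyramid r x * partial i g x)) /\
  \int[leb3]_x (coord3 (octa r) i x * g x + pyramid r x * partial i g x) = 0.
Proof.
move=> dg cg cg'.
have I : leb3.-integrable setT (EFin \o
    (fun x => coord3 (octa r) i x * g x + pyramid r x * partial i g x)).
  apply: integrable_add.
    apply: (@integrable_mul_continuous r 1) => //.
    - exact: mfield_octa.
    - exact: octa_le1.
    - by move=> x /negP/negbTE xr; rewrite octaE xr.
  apply: (@integrable_mul_continuous r ((Num.sqrt 3)^-1 * Num.max 0 r)) => //.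
  - apply: measurable_funM => //; apply: measurable_maxr => //.
    by apply: measurable_funB => //; exact: (continuous_measurable3 continuous_norm1).
  - move=> x; have s0 : 0 <= (Num.sqrt 3)^-1 :> R by rewrite invr_ge0 sqrtr_ge0.
    rewrite /pyramid normrM (ger0_norm s0) ler_wpM2l// ger0_norm ?le_max ?lexx//.
    have n0 : 0 <= norm1 x by rewrite /norm1 !addr_ge0.
    by case: (leP 0 (r - norm1 x)) => h; case: (leP 0 r) => h'; lra.
  - by move=> x /negP; rewrite -leNgt -subr_le0 /pyramid => xr; rewrite max_l ?mulr0.
split=> //; rewrite /Rintegral [X in fine X](_ : _ = 0%E)//.
apply: (@leb3_slice_eq0 _ i) => // x.
pose c : R := (Num.sqrt 3)^-1.
rewrite -[RHS](@tent_by_parts R (radius r i x) (fun t => c * g (upd i x t))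
  (fun t => c * partial i g (upd i x t))).
- apply: eq_integral => t _; congr (_%:E).
  rewrite (pyramid_tent _ i) /coord3 mxE coor_upd radius_upd -/c; ring.
- move=> t; have D := is_derive_slice x t dg.
  by have := @is_deriveZ _ _ _ _ c _ _ _ D.
- move=> t; apply: cvgM; first exact: cvg_cst.
  by apply: (@continuous_comp _ _ _ (upd i x)); [exact: continuous_upd|exact: cg'].
Qed.

Lemma curl_coordE (phi : vfield R) i : coord3 (curl phi) i =
  (partial (i + 1) (coord3 phi (i + 2)) - partial (i + 2) (coord3 phi (i + 1))).
Proof. by apply/funext => x; rewrite /coord3 mxE. Qed.

Lemma partial_curl_coord (phi : vfield R) i : test_field phi ->
  [/\ (forall x, derivable (coord3 (curl phi) i) x (basis3 R i)),
      continuous (partial i (coord3 (curl phi) i)) &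
      forall x, partial i (coord3 (curl phi) i) x =
        partial i (partial (i + 1) (coord3 phi (i + 2))) x -
        partial i (partial (i + 2) (coord3 phi (i + 1))) x].
Proof.
move=> [sphi _].
have d2 k l m y : derivable (partial k (coord3 phi l)) y (basis3 R m).
  by have [_ /(_ m)[]] := sphi l 2 k.
have c2 k l m : continuous (partial m (partial k (coord3 phi l))).
  by have [_ /(_ m)[]] := sphi l 2 k.
have E x : partial i (coord3 (curl phi) i) x =
        partial i (partial (i + 1) (coord3 phi (i + 2))) x -
        partial i (partial (i + 2) (coord3 phi (i + 1))) x.
  by rewrite curl_coordE; exact: deriveB.
split => //; first by move=> x; rewrite curl_coordE; exact: derivableB.
have -> : partial i (coord3 (curl phi) i) = fun x =>
        partial i (partial (i + 1) (coord3 phi (i + 2))) x -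
        partial i (partial (i + 2) (coord3 phi (i + 1))) x by apply/funext.
by move=> x; apply: cvgB; exact: c2.
Qed.

Lemma divergence_curl (phi : vfield R) x : test_field phi ->
  partial 0 (coord3 (curl phi) 0) x + partial 1 (coord3 (curl phi) 1) x +
  partial 2 (coord3 (curl phi) 2) x = 0.
Proof.
move=> tphi; have [sphi _] := tphi.
have [_ _ ->] := partial_curl_coord 0 tphi.
have [_ _ ->] := partial_curl_coord 1 tphi.
have [_ _ ->] := partial_curl_coord 2 tphi.
have [e1 e2 e3] : [/\ 0 + 1 = 1 :> 'I_3, 1 + 1 = 2 :> 'I_3 & 2 + 1 = 0 :> 'I_3].
  by split; apply/val_inj.
have [e4 e5 e6] : [/\ 0 + 2 = 2 :> 'I_3, 1 + 2 = 0 :> 'I_3 & 2 + 2 = 1 :> 'I_3].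
  by split; apply/val_inj.
rewrite e1 e2 e3 e4 e5 e6.
rewrite (partialC 1 0 x (sphi 2 2%N)) (partialC 2 0 x (sphi 1 2%N)).
rewrite (partialC 2 1 x (sphi 0 2%N)).
have telescope (a b c : R) : a - b + (c - a) + (b - c) = 0 by ring.
exact: telescope.
Qed.

(** Integrating by parts moves the derivatives onto curl phi, whose divergence
    vanishes: a gradient has no curl. *)
Lemma octa_curl_free r : is_weak_curl (octa r) (fun=> 0).
Proof.
move=> phi tphi.
rewrite (@eq_Rintegral _ _ _ _ _ (fun=> 0)); last first.
  by move=> x _; rewrite dotE !mxE; ring.
rewrite Rintegral_cst// mul0r; apply/esym.
have P i := partial_curl_coord i tphi.
have H i := @octa_by_parts r i (coord3 (curl phi) i) (let: And3 d _ _ := P i in d)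
  (tame_curl tphi i).1 (let: And3 _ c _ := P i in c).
rewrite (@eq_Rintegral _ _ _ _ _ (fun x : T3 =>
  (coord3 (octa r) 0 x * coord3 (curl phi) 0 x +
     pyramid r x * partial 0 (coord3 (curl phi) 0) x) +
  (coord3 (octa r) 1 x * coord3 (curl phi) 1 x +
     pyramid r x * partial 1 (coord3 (curl phi) 1) x) +
  (coord3 (octa r) 2 x * coord3 (curl phi) 2 x +
     pyramid r x * partial 2 (coord3 (curl phi) 2) x))).
  rewrite RintegralD//; [|by apply: integrable_add; exact: (H _).1|exact: (H _).1].
  by rewrite RintegralD//; [|exact: (H _).1|exact: (H _).1]; rewrite !(H _).2 !addr0.
move=> x _; have D := divergence_curl x tphi; rewrite dotE /coord3 in D *.
set a := pyramid r x in D *.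
by rewrite -[LHS](addr0) -[X in _ + X](mulr0 a) -D; ring.
Qed.

Lemma octa_Lp3 r (p : R) : 0 < p -> Lp3 p (octa r).
Proof.
move=> p0; apply/Lp3P => //; split; first exact: mfield_octa.
apply: (@bounded_cube_integrable _ _ 1 r).
- by apply: mfield_powR; exact: mfield_octa.
- move=> x xr; rewrite enorm_octa; case: (boolP (norm1 x < r)) => [/norm1_cube//|_].
  by rewrite powR0// gt_eqF.
- move=> x; rewrite enorm_octa.
  by case: (_ < _); rewrite ?powR1 ?normr1// powR0 ?normr0// gt_eqF.
Qed.

End octahedron.

(** * The energy of solutions *)

Section variational.
Variable R : realType.
Variable q : R.
Hypothesis q1 : 1 < q.
Local Notation mR := (measurableTypeR R).
Local Notation T3 := (mR * mR * mR)%type.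
Local Notation leb3 := (leb3 R).
Implicit Types (E F H : vfield R).

Let q20 : 0 < 2 * q. Proof. by rewrite mulr_gt0 ?(lt_trans ltr01 q1). Qed.

Let qn0 : q != 0. Proof. by rewrite gt_eqF// (lt_trans ltr01 q1). Qed.

Definition quad E : R := \int[leb3]_x (enorm (wcurl E x) ^+ 2 + enorm (E x) ^+ 2).

Definition power E : R := \int[leb3]_x (enorm (E x) `^ (2 * q)).

Lemma energyE E : energy q E = 2^-1 * quad E - (2 * q)^-1 * power E.
Proof. by []. Qed.

Lemma normXE E : normX q E = Num.sqrt (quad E) + power E `^ ((2 * q)^-1).
Proof. by []. Qed.

Lemma quad_ge0 E : 0 <= quad E.
Proof. by apply: Rintegral_ge0 => x _; rewrite addr_ge0// sqr_ge0. Qed.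

Lemma power_ge0 E : 0 <= power E.
Proof. by apply: Rintegral_ge0 => x _; rewrite powR_ge0. Qed.

Lemma integrable_quad E : Hcurl E ->
  leb3.-integrable setT (EFin \o (fun x => enorm (wcurl E x) ^+ 2 + enorm (E x) ^+ 2)).
Proof.
move=> HE; have [/L2P[_ w2] _] := wcurlP HE; have [/L2P[_ E2] _] := HE.
exact: integrable_add.
Qed.

Lemma measurable_sq E : mfield E ->
  measurable_fun (setT : set T3) (fun x => enorm (E x) ^+ 2).
Proof. by move=> mE; apply: measurable_funX; exact: mfield_enorm. Qed.

Lemma quad_ae E F : Lp3 2 E -> Lp3 2 F -> is_weak_curl E F ->
  quad E = \int[leb3]_x (enorm (F x) ^+ 2 + enorm (E x) ^+ 2).
Proof.
move=> E2 F2 cF.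
have HE : Hcurl E by split => //; exists F.
have [[mw _] _] := wcurlP HE.
apply: ae_eq_Rintegral.
- by apply: measurable_funD; apply: measurable_sq => //; case: E2.
- by apply: measurable_funD; apply: measurable_sq; [case: F2|case: E2].
- by apply: ae_leb3S (wcurl_ae F2 cF E2) => x ->.
Qed.

(** Scaling as a special case of E + c F, which is the form in which the lemmas
    on linearity are stated. *)
Lemma scaleE (c : R) E :
  (fun x => c *: E x) = (fun x => E x + (c - 1) *: E x) :> vfield R.
Proof.
by apply/funext => x; rewrite -{2}[E x]scale1r -scalerDl addrC subrK.
Qed.

Lemma Xspace_lin E H (c : R) : Xspace q E -> Xspace q H ->
  Xspace q (fun x => E x + c *: H x).
Proof.
by move=> [HE pE] [HH pH]; split; [exact: Hcurl_lin|exact: Lp3_lin].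
Qed.

Lemma Xspace_scale c E : Xspace q E -> Xspace q (fun x => c *: E x).
Proof. by move=> XE; rewrite scaleE; exact: Xspace_lin. Qed.

Lemma quad_scale c E : Hcurl E -> quad (fun x => c *: E x) = c ^+ 2 * quad E.
Proof.
move=> HE; have [w2 cw] := wcurlP HE; have [E2 _] := HE.
have cE2 : Lp3 2 (fun x => c *: E x) by rewrite scaleE; exact: Lp3_lin.
have cw2 : Lp3 2 (fun x => c *: wcurl E x) by rewrite scaleE; exact: Lp3_lin.
have cc : is_weak_curl (fun x => c *: E x) (fun x => c *: wcurl E x).
  by rewrite !scaleE; exact: is_weak_curl_lin.
rewrite (quad_ae cE2 cw2 cc) -RintegralZl//; last exact: integrable_quad.
apply: eq_Rintegral => x _; rewrite !enormZ !exprMn real_normK ?num_real//; ring.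
Qed.

Lemma power_scale c E : Lp3 (2 * q) E ->
  power (fun x => c *: E x) = `|c| `^ (2 * q) * power E.
Proof.
move=> /(Lp3P _ q20)[mE iE]; rewrite /power -RintegralZl//.
by apply: eq_Rintegral => x _; rewrite enormZ powRM// enorm_ge0.
Qed.

Lemma normX_ge0 E : 0 <= normX q E.
Proof. by rewrite normXE addr_ge0 ?sqrtr_ge0 ?powR_ge0. Qed.

Lemma normX_scale c E : Xspace q E -> normX q (fun x => c *: E x) = `|c| * normX q E.
Proof.
move=> [HE pE]; rewrite !normXE quad_scale// power_scale//.
rewrite sqrtrM ?sqr_ge0// sqrtr_sqr powRM ?powR_ge0 ?power_ge0//.
by rewrite -powRrM mulfV ?gt_eqF// powRr1// mulrDr.
Qed.

(** The derivative of the energy in the direction E itself is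
    [quad E - power E]; it is computed from the homogeneity of the two terms
    along the ray (1 + t) E. *)
Lemma critical_point_nehari E : Xspace q E -> critical_point q E -> quad E = power E.
Proof.
move=> XE cE; have [HE pE] := XE.
set A := quad E; set B := power E; set N := normX q E.
have A0 : 0 <= A := quad_ge0 E; have B0 : 0 <= B := power_ge0 E.
have N0 : 0 <= N := normX_ge0 E.
have [C C0 HC] : exists2 C : R, 0 <= C &
    forall s : R, 0 <= s <= 4 ->
    `|s `^ (2 * q) - 1 - 2 * q * (s - 1)| <= C * (s - 1) ^+ 2.
  by have q1' := q1; apply: powR_tangent_error; lra.
pose D := 2^-1 * A + (2 * q)^-1 * C * B.
have i0 : 0 < (2 * q)^-1 by rewrite invr_gt0.
have D0 : 0 <= D by rewrite /D addr_ge0// ?mulr_ge0// ltW.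
(* The difference quotient of the energy along E is A - B up to O(t). *)
have key (t : R) : 0 < t <= 1 -> t * `|A - B| <=
    `|energy q (fun x => (1 + t) *: E x) - energy q E| + t ^+ 2 * D.
  move=> /andP[t0 t1].
  rewrite !energyE quad_scale// power_scale// -/A -/B.
  rewrite (gtr0_norm (_ : 0 < 1 + t)); last lra.
  have := HC (1 + t); rewrite [1 + t - 1]addrC addKr.
  have -> : 0 <= 1 + t <= 4 by apply/andP; split; lra.
  move=> /(_ isT); set P := (1 + t) `^ (2 * q) => hP.
  pose rho := P - 1 - 2 * q * t.
  have -> : t * `|A - B| = `|t * (A - B)| by rewrite normrM gtr0_norm.
  have PE : P = 1 + 2 * q * t + rho by rewrite /rho; ring.
  have -> : t * (A - B) = (2^-1 * ((1 + t) ^+ 2 * A) - (2 * q)^-1 * (P * B) -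
     (2^-1 * A - (2 * q)^-1 * B)) + ((2 * q)^-1 * (rho * B) - 2^-1 * (t ^+ 2 * A)).
    rewrite PE; field; exact: qn0.
  apply: (le_trans (ler_normD _ _)); rewrite lerD2l.
  apply: (le_trans (ler_normB _ _)).
  rewrite !normrM (ger0_norm A0) (ger0_norm B0) (gtr0_norm i0).
  rewrite (gtr0_norm (_ : 0 < 2^-1))//.
  rewrite (gtr0_norm t0) /D.
  have h : (2 * q)^-1 * (`|rho| * B) <= (2 * q)^-1 * (C * t ^+ 2 * B).
    by rewrite ler_wpM2l ?(ltW i0)// ler_wpM2r.
  by lra.
apply/eqP; rewrite -subr_eq0 -normr_le0; apply/ler_addgt0Pl => e e0; rewrite addr0.
have eN : 0 < e / 2 / (N + 1) by rewrite !divr_gt0//; lra.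
have [delta d0 Hd] := cE _ eN.
pose t := Num.min 1 (Num.min (delta / 2 / (N + 1)) (e / 2 / (D + 1))).
have t0 : 0 < t by rewrite /t !lt_min ltr01 !divr_gt0//; lra.
have t1 : t <= 1 by rewrite /t ge_min lexx.
have t2 : t * (N + 1) <= delta / 2.
  by rewrite -ler_pdivlMr; [rewrite /t !ge_min lexx !orbT|lra].
have t3 : t * (D + 1) <= e / 2.
  by rewrite -ler_pdivlMr; [rewrite /t !ge_min lexx !orbT|lra].
have XtE := Xspace_scale t XE.
have nt : normX q (fun x => t *: E x) = t * N by rewrite normX_scale// gtr0_norm.
have := Hd _ XtE; rewrite nt => /(_ _)/wrap[]; first by nra.
have -> : E + (fun x => t *: E x) = (fun x => (1 + t) *: E x).
  by apply/funext => x; rewrite /= scalerDl scale1r.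
have t01 : 0 < t <= 1 by rewrite t0.
have := key t t01.
set en := `|energy _ _ - _| => k1 k2.
have k3 : e / 2 / (N + 1) * N <= e / 2.
  rewrite -mulrA ler_piMr//; first lra.
  by rewrite mulrC ler_pdivrMr; lra.
have k4 : t * `|A - B| <= t * e.
  apply: (le_trans k1); apply: (@le_trans _ _ (t * (e / 2) + t * (e / 2))); last by lra.
  by apply: lerD; [apply: (le_trans k2); rewrite mulrCA ler_wpM2l// ltW|
    rewrite expr2 -mulrA ler_wpM2l ?(ltW t0)//; nra].
by rewrite -(ler_pM2l t0).
Qed.

Lemma nontrivial_quad_gt0 E : Hcurl E -> nontrivial E -> 0 < quad E.
Proof.
move=> HE nE; rewrite lt_neqAle quad_ge0 andbT; apply/negP => /eqP Q0.
apply: nE.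
have iq := integrable_quad HE.
have I0 : (\int[leb3]_x `|(enorm (wcurl E x) ^+ 2 + enorm (E x) ^+ 2)%:E| = 0)%E.
  under eq_integral do rewrite /= ger0_norm ?addr_ge0 ?sqr_ge0//.
  rewrite -[LHS]fineK; last exact: (integrable_fin_num measurableT iq).
  by move: Q0; rewrite /quad /Rintegral => <-.
have mq := measurable_int _ iq.
have := (ae_eq_integral_abs leb3 measurableT mq).1 I0 => ae0.
apply: ae_leb3S ae0 => x /(_ Logic.I) [] h.
apply: enorm_eq0; have := sqr_ge0 (enorm (wcurl E x)); have := enorm_ge0 (E x); nra.
Qed.

Lemma energy_solution E : solution q E -> energy q E = (2^-1 - (2 * q)^-1) * quad E.
Proof.
by move=> [XE cE]; rewrite energyE -(critical_point_nehari XE cE) mulrBl.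
Qed.

(** As 2 q > 2, small fields have both terms of the energy bounded by the square
    of the norm, hence negligible at first order. *)
Lemma normX_bounds H : normX q H <= 1 ->
  quad H <= normX q H ^+ 2 /\ power H <= normX q H ^+ 2.
Proof.
move=> N1; have N0 := normX_ge0 H.
have s1 : Num.sqrt (quad H) <= normX q H by rewrite normXE lerDl powR_ge0.
have p1 : power H `^ ((2 * q)^-1) <= normX q H by rewrite normXE lerDr sqrtr_ge0.
split.
  by rewrite -(sqr_sqrtr (quad_ge0 H)) lerXn2r ?nnegrE ?sqrtr_ge0.
have -> : power H = (power H `^ ((2 * q)^-1)) `^ (2 * q).
  by rewrite -powRrM mulVf ?gt_eqF// powRr1// power_ge0.
apply: (@le_trans _ _ (normX q H `^ (2 * q))).
  by rewrite ge0_ler_powR ?nnegrE ?powR_ge0 ?(ltW q20).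
rewrite -powR_mulrn//.
have [->|n0] := eqVneq (normX q H) 0.
  by rewrite !powR0 ?gt_eqF.
have n1 : 0 < normX q H <= 1 by rewrite N1 andbT lt_neqAle eq_sym n0.
by rewrite ger_powR//; have q1' := q1; lra.
Qed.

(** The first order term of [energy (E + H) - energy E] is the integral of
    E.H - |E| ^ (2 q - 2) E.H, which is 0 since |E| is 0 or 1 everywhere; there
    is no term in the curl of H because E has none. What remains is quadratic in
    the norm of H by [power_remainder] and [normX_bounds]. *)
Lemma curl_free_unit_critical E : Xspace q E -> is_weak_curl E (fun=> 0) ->
  (forall x, E x = 0 \/ enorm (E x) = 1) -> critical_point q E.
Proof.
move=> XE cE01 E01 eps eps0.
have [HE pE] := XE; have [E2 _] := HE.
have [C C0 HC] := power_remainder q1.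
have z2 : Lp3 2 (fun=> 0 : 'rV[R]_3) by exact: Lp3_zero.
have i0 : 0 < (2 * q)^-1 by rewrite invr_gt0.
pose K := 2^-1 + 2 * (2 * q)^-1 * C.
have K0 : 0 < K by rewrite /K ltr_wpDr// !mulr_ge0// ltW.
exists (Num.min 1 (eps / K)); first by rewrite lt_min ltr01 divr_gt0.
move=> H XH; rewrite lt_min => /andP[/ltW N1 NK].
have [HH pH] := XH; have [H2 _] := HH.
have [qH pwH] := normX_bounds N1.
have N0 := normX_ge0 H.
have -> : E + H = (fun x => E x + 1 *: H x) by apply/funext => x; rewrite /= scale1r.
have XS := Xspace_lin 1 XE XH; have [_ pS] := XS.
have [w2 cw] := wcurlP HH.
have S2 := Lp3_lin 1 (ltr0Sn R 1) E2 H2.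
have /L2P[mE iE] := E2; have /L2P[mH iH] := H2; have /L2P[mw iw] := w2.
have /(Lp3P _ q20)[_ ipE] := pE; have /(Lp3P _ q20)[_ ipH] := pH.
have /(Lp3P _ q20)[_ ipS] := pS.
have id : leb3.-integrable setT (EFin \o (fun x => dot (E x) (H x))).
  apply: (@dom_integrable _ _ (fun x => enorm (E x) ^+ 2 + enorm (H x) ^+ 2)).
  - exact: mfield_dot.
  - move=> x; apply: (le_trans (dot_cauchy_schwarz _ _)).
    by have := enorm_ge0 (E x); have := enorm_ge0 (H x);
      have := sqr_ge0 (enorm (E x) - enorm (H x)); nra.
  - exact: integrable_add.
have iqH := integrable_quad HH.
have qE : quad E = \int[leb3]_x enorm (E x) ^+ 2.
  rewrite (quad_ae E2 z2 cE01); apply: eq_Rintegral => x _.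
  by rewrite enorm0 expr0n add0r.
have qS : quad (fun x => E x + 1 *: H x) =
    quad H + quad E + 2 * \int[leb3]_x dot (E x) (H x).
  have cS : is_weak_curl (fun x => E x + 1 *: H x) (fun x => 0 + 1 *: wcurl H x).
    exact: is_weak_curl_lin.
  have wS2 := Lp3_lin 1 (ltr0Sn R 1) z2 w2.
  rewrite (quad_ae S2 wS2 cS) qE /quad -RintegralZl// -!RintegralD//.
  - apply: eq_Rintegral => x _; rewrite add0r !scale1r !enorm_sq !dotE !mxE; ring.
  - exact: integrable_add.
  - exact: integrable_scale.
pose rem x := enorm (E x + 1 *: H x) `^ (2 * q) - enorm (E x) `^ (2 * q) -
  2 * q * dot (E x) (H x).
have iqd := integrable_scale (2 * q) id.
have iSE : leb3.-integrable setT (EFin \o (fun x =>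
    enorm (E x + 1 *: H x) `^ (2 * q) - enorm (E x) `^ (2 * q))).
  have := integrable_add ipS (integrable_scale (-1) ipE).
  by under eq_fun do rewrite mulN1r.
have pwS : power (fun x => E x + 1 *: H x) =
    power E + 2 * q * \int[leb3]_x dot (E x) (H x) + \int[leb3]_x rem x.
  rewrite /power /rem RintegralB// RintegralB// RintegralZl//.
  by move: (Rintegral _ _ _) (Rintegral _ _ _) (Rintegral _ _ _) => a b c; ring.
pose bd x := C * ((enorm (wcurl H x) ^+ 2 + enorm (H x) ^+ 2) +
  enorm (H x) `^ (2 * q)).
have iC : leb3.-integrable setT (EFin \o bd).
  by apply: integrable_scale; exact: integrable_add.
have remC x : `|rem x| <= bd x.
  rewrite /rem scale1r; apply: le_trans (HC _ _ (E01 x)) _.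
  rewrite ler_wpM2l// lerD2r.
  by rewrite lerDr sqr_ge0.
have mrem : measurable_fun (setT : set T3) rem.
  apply: measurable_funB; last by apply: measurable_funM => //; exact: mfield_dot.
  by apply: measurable_funB; apply: mfield_powR => //; exact: mfield_lin.
have irem : leb3.-integrable setT (EFin \o rem) by exact: (dom_integrable mrem remC iC).
have Rrem : `|\int[leb3]_x rem x| <= C * (quad H + power H).
  apply: (le_trans (le_normr_Rintegral _ irem)) => //.
  rewrite /quad /power -RintegralD// -RintegralZl//; last exact: integrable_add.
  apply: le_Rintegral => //.
  apply: (dom_integrable _ _ iC); last by move=> x; rewrite normr_id.
  by apply: measurableT_comp.
rewrite !energyE qS pwS.
rewrite [X in `|X|](_ : _ = 2^-1 * quad H - (2 * q)^-1 * \int[leb3]_x rem x);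
  last by field; exact: qn0.
apply: (le_trans (ler_normB _ _)).
rewrite !normrM (gtr0_norm i0) (gtr0_norm (_ : 0 < 2^-1))//.
rewrite (ger0_norm (quad_ge0 H)).
have h1 : (2 * q)^-1 * `|\int[leb3]_x rem x| <=
    (2 * q)^-1 * (C * (normX q H ^+ 2 + normX q H ^+ 2)).
  rewrite ler_wpM2l ?(ltW i0)//; apply: (le_trans Rrem); rewrite ler_wpM2l//.
  exact: lerD.
have h2 : K * normX q H ^+ 2 <= eps * normX q H.
  rewrite expr2 mulrA ler_wpM2r// mulrC -ler_pdivlMr//; exact: ltW.
have hK n : K * n = 2^-1 * n + (2 * q)^-1 * (C * (n + n)) by rewrite /K; ring.
by apply: le_trans h2; rewrite hK; apply: lerD => //; rewrite ler_wpM2l.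
Qed.

End variational.

(** * Solutions of small energy *)

Section octahedral_solutions.
Variable R : realType.
Variable q : R.
Hypothesis q1 : 1 < q.
Local Notation mR := (measurableTypeR R).
Local Notation T3 := (mR * mR * mR)%type.
Local Notation leb3 := (leb3 R).

Lemma octa_solution (r : R) : solution q (octa r).
Proof.
have q20 : 0 < 2 * q by rewrite mulr_gt0 ?(lt_trans ltr01 q1).
have z2 : Lp3 2 (fun=> 0 : 'rV[R]_3) by exact: Lp3_zero.
have X : Xspace q (octa r).
  split; last exact: octa_Lp3.
  split; first exact: octa_Lp3.
  by exists (fun=> 0); split => //; exact: octa_curl_free.
split => //; apply: curl_free_unit_critical => //; first exact: octa_curl_free.
move=> x; case: (boolP (norm1 x < r)) => xr; [right|left].
  by rewrite enorm_octa xr.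
by apply: enorm_eq0; rewrite enorm_octa (negbTE xr).
Qed.

(** A cube of side r / 3 in the positive octant lies in the octahedron. *)
Lemma octa_nontrivial (r : R) : 0 < r -> nontrivial (octa r).
Proof.
move=> r0 [N [mN N0 sN]].
pose b : R := r / 3.
have b0 : 0 < b by rewrite divr_gt0.
pose Q := obox (0, 0, 0) (b, b, b).
have : (leb3 Q <= leb3 N)%E.
  apply: le_measure; rewrite ?inE//; first exact: measurable_obox.
  move=> x [[/= h1 h2] h3]; apply: sN => /= x0.
  move: h1 h2 h3; rewrite !in_itv/= => /andP[h1 h1'] /andP[h2 h2'] /andP[h3 h3'].
  have xr : norm1 x < r by rewrite /norm1 !gtr0_norm//; rewrite /b in h1' h2' h3'; lra.
  have := enorm_octa r x; rewrite x0 enorm0 xr => /esym/eqP.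
  by rewrite oner_eq0.
rewrite N0 leNgt => /negP; apply.
rewrite /Q /obox leb3_prod//=; try exact: measurable_itv.
by rewrite lebesgue_measure_itv/= lte_fin b0 -EFinB subr0 -!EFinM lte_fin !mulr_gt0.
Qed.

(** The octahedron lies in a cube of side 2 r, and the weak curl vanishes almost
    everywhere. *)
Lemma octa_quad_le (r : R) : 0 <= r -> quad (octa r) <= (r *+ 2) ^+ 3.
Proof.
move=> r0.
have z2 : Lp3 2 (fun=> 0 : 'rV[R]_3) by exact: Lp3_zero.
have O2 : Lp3 2 (octa r) by exact: octa_Lp3.
have /L2P[_ iO] := O2.
have mc := measurable_cube r.
rewrite (quad_ae O2 z2 (octa_curl_free r)).
have Ec : (r *+ 2) ^+ 3 = \int[leb3]_x (\1_(cube r) x).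
  by rewrite /Rintegral integral_indic// setIT leb3_cube.
rewrite Ec; apply: le_Rintegral => //.
- apply: eq_integrable iO => // x _ /=.
  by rewrite enorm0 expr0n add0r.
- apply: (@bounded_cube_integrable _ _ 1 r) => //.
  + by move=> x xr; rewrite indicE memNset.
  + by move=> x; rewrite indicE; case: (_ \in _); rewrite ?normr1 ?normr0.
- move=> x _; rewrite enorm0 expr0n add0r enorm_octa indicE.
  case: (boolP (norm1 x < r)) => [/norm1_cube xr|_]; first by rewrite mem_set ?expr1n.
  by rewrite expr0n.
Qed.

End octahedral_solutions.

Unset Implicit Arguments.

Theorem proposition1 (R : realType) (q : R) (hq : 1 < q) :
  ~ exists E : vfield R, ground_state q E.
Proof.
move=> [E [sE nE minE]].
have q2 : 0 < 2^-1 - (2 * q)^-1 by rewrite subr_gt0 ltf_pV2 ?posrE; lra.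
have q2' : 2^-1 - (2 * q)^-1 <= 2^-1 by rewrite gerBl invr_ge0; lra.
have eE : 0 < energy q E.
  rewrite (energy_solution hq sE) mulr_gt0//; apply: nontrivial_quad_gt0 => //.
  by case: sE => -[].
pose r := Num.min 1 (energy q E / 8).
have r0 : 0 < r by rewrite lt_min ltr01 divr_gt0.
have r1 : r <= 1 by rewrite ge_min lexx.
have re : r <= energy q E / 8 by rewrite ge_min lexx orbT.
have := minE _ (octa_solution hq r) (octa_nontrivial r0).
apply/negP; rewrite -ltNge (energy_solution hq (octa_solution hq r)).
have h := octa_quad_le (ltW r0).
apply: (@le_lt_trans _ _ (2^-1 * (r *+ 2) ^+ 3)).
  by apply: ler_pM => //; [exact: ltW|exact: quad_ge0].
have r3 : r ^+ 3 <= r by rewrite -[leRHS]expr1; apply: ler_wiXn2l => //; exact: ltW.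
have -> : (r *+ 2) ^+ 3 = 8 * r ^+ 3 by ring.
by lra.
Qed.
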